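(* Let $\mathcal H$ be a separable complex Hilbert space, $\Omega$ a locally compact Hausdorff space, $U\subset\mathbb R^m$ an open set, $q\in\mathbb Z_+$, and $p:\Omega\times U\times U\to\mathbb C$ a function in $C^{0,q,q}(\Omega\times U\times U)$ such that the kernels $p_w(x,y):=p(w,x,y)$ on $U$ are positive definite for all $w\in\Omega$. Let $\Lambda:\mathscr B(\Omega)\to\mathcal L(\mathcal H)$ be a Radon nonnegative finite operator valued measure that admits a Radon-Nikodym decomposition $d\Lambda=G\,d\lambda$. Suppose in addition that $p$ is $C^q$-dominated with respect to $|\Lambda|$. Then the kernels $$P_{\alpha,\beta}(x,y):=\int_\Omega\partial_1^\alpha\partial_2^\beta p_w(x,y)\,d\Lambda(w)\in\mathcal L(\mathcal H),\quad (x,y)\in U\times U,\ |\alpha|,|\beta|\le q,$$ are well defined, $P_{\alpha,\beta}\in C^{q-|\alpha|,q-|\beta|}(U\times U,\mathcal L(\mathcal H))$, and, with $P:=P_{0,0}$, $$\partial_1^\alpha\partial_2^\beta P(x,y)=P_{\alpha,\beta}(x,y),\quad|\alpha|,|\beta|\le q.$$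
   Context: A scalar kernel $k:U\times U\to\mathbb C$ is positive definite if $\sum_{i,j}c_i\overline{c_j}k(x_i,x_j)\ge0$ for all finite families of distinct points and complex scalars. $C^{0,q,q}(\Omega\times U\times U)$: functions $p$ for which all derivatives $\partial_1^\alpha\partial_2^\beta p_w(x,y)$, $|\alpha|,|\beta|\le q$ (of order $\alpha$ in $x$ and $\beta$ in $y$), exist and are jointly continuous on $\Omega\times U\times U$. $C^{r,s}(U\times U,\mathcal L(\mathcal H))$: kernels whose derivatives $\partial_1^\alpha\partial_2^\beta$, $|\alpha|\le r$, $|\beta|\le s$, exist in the operator norm and are norm-continuous on $U\times U$. $p$ is $C^q$-dominated with respect to a finite nonnegative Radon measure $\sigma$ on $\Omega$ if there is a $\sigma$-integrable $h:\Omega\to\mathbb C$ with $|\partial_1^\alpha\partial_2^\beta p_w(x,y)|\le|h(w)|$ for all $w\in\Omega$, $x,y\in U$, $|\alpha|,|\beta|\le q$. A Radon nonnegative finite operator valued measure with Radon-Nikodym decomposition $d\Lambda=G\,d\lambda$ is a (norm) countably additive $\Lambda:\mathscr B(\Omega)\to\mathcal L(\mathcal H)$ on the Borel sets, of bounded variation, with every $\Lambda(A)$ positive semidefinite, whose variation $|\Lambda|$ is Radon (outer regular on Borel sets, inner regular by compact sets on open sets), and such that $\Lambda(A)=\int_AG\,d\lambda$ for a finite nonnegative scalar measure $\lambda$ and a Bochner $\lambda$-integrable $G:\Omega\to\mathcal L(\mathcal H)$. Then $d|\Lambda|=\|G\|_{\mathcal L(\mathcal H)}d\lambda$, and for $|\Lambda|$-integrable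 $g$, $\int g\,d\Lambda=\int gG\,d\lambda$ (Bochner integral). *)

(* Defs.v *)
From HB Require Import structures.
From mathcomp Require Export all_boot all_order all_algebra complex.
From mathcomp Require Export all_classical all_reals all_analysis.
Export Order.TTheory GRing.Theory Num.Theory.
Export numFieldNormedType.Exports.

Set Implicit Arguments.
Unset Strict Implicit.
Unset Printing Implicit Defensive.

Local Open Scope classical_set_scope.
Local Open Scope ring_scope.
Local Open Scope complex_scope.

Section real_norm.
Variables (R : realType) (E : normedModType R[i]).

(* The norm of a complex normed module takes its values in R[i]; this is the
   same number seen in R. *)
Definition rnorm (u : E) : R := complex.Re `|u|.

Lemma rnormE u : `|u| = (rnorm u)%:C.
Proof. by rewrite /rnorm; apply/esym/RRe_real; apply: ger0_real. Qed.

Lemma rnorm_ge0 u : 0 <= rnorm u.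
Proof. by rewrite -ler0c -rnormE. Qed.

Lemma rnorm0 : rnorm 0 = 0.
Proof. by rewrite /rnorm normr0. Qed.

Lemma rnormD u v : rnorm (u + v) <= rnorm u + rnorm v.
Proof. by rewrite -lecR rmorphD /= -!rnormE ler_normD. Qed.

Lemma rnormZ (a : R[i]) u : rnorm (a *: u) = complex.Re `|a| * rnorm u.
Proof.
by rewrite /rnorm normrZ [`|u|]rnormE; case: `|a| => x y /=; rewrite mulr0 subr0.
Qed.

End real_norm.

Section bounded_operators.
Variables (R : realType) (E F : normedModType R[i]).

Definition bounded_linear : {pred (E -> F)} :=
  mem [set f : E -> F | linear f /\
    exists M : R, forall u, rnorm (f u) <= M * rnorm u].

Lemma bounded_linear_submod : submod_closed bounded_linear.
Proof.
split=> [|a f g].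
  rewrite inE; split=> [b u v|]; first by rewrite -[RHS]/(b *: 0 + 0 : F) scaler0 addr0.
  by exists 0 => u; rewrite mul0r; rewrite -[0 u]/(0 : F) rnorm0.
rewrite !inE => -[lf [M fM]] [lg [N gN]]; split=> [b u v|].
  rewrite -![(a *: f + g) _]/(a *: f _ + g _) lf lg !scalerDr !scalerA.
  by rewrite [a * b]mulrC addrACA.
exists (complex.Re `|a| * M + N) => u.
rewrite -[(a *: f + g) _]/(a *: f _ + g _).
rewrite (le_trans (rnormD _ _)) // mulrDl lerD // rnormZ -mulrA ler_wpM2l //.
by rewrite -ler0c RRe_real // ger0_real.
Qed.

HB.instance Definition _ :=
  GRing.isSubmodClosed.Build R[i] (E -> F) bounded_linear
    bounded_linear_submod.

Record bop := Bop { bop_fun :> E -> F ; _ : bop_fun \in bounded_linear }.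

HB.instance Definition _ := [isSub for bop_fun].
HB.instance Definition _ := gen_eqMixin bop.
HB.instance Definition _ := gen_choiceMixin bop.
HB.instance Definition _ := [SubChoice_isSubLmodule of bop by <:].

Lemma bopP (f g : bop) : f =1 g -> f = g.
Proof. by move=> /funext fg; apply: val_inj. Qed.

Lemma bop_linear (f : bop) : linear f.
Proof. by case: f => f /=; rewrite inE => -[]. Qed.

Lemma bop_bounded (f : bop) :
  exists M : R, forall u, rnorm (f u) <= M * rnorm u.
Proof. by case: f => f /=; rewrite inE => -[]. Qed.

HB.instance Definition _ (f : bop) := GRing.isLinear.Build R[i] E F *:%R f
  (bop_linear f).

Definition opnorm (f : bop) : R :=
  sup [set rnorm (f u) | u in [set u | rnorm u <= 1]].

Lemma opnorm_has_sup (f : bop) :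
  has_sup [set rnorm (f u) | u in [set u | rnorm u <= 1]].
Proof.
split; first by exists (rnorm (f 0)), 0 => //=; rewrite rnorm0 ler01.
have [M fM] := bop_bounded f.
exists (Num.max M 0) => _ [u /= u1 <-]; rewrite (le_trans (fM u)) //.
rewrite (@le_trans _ _ (Num.max M 0 * rnorm u)) //.
  by rewrite ler_wpM2r ?rnorm_ge0 // le_max lexx.
by rewrite ler_piMr // le_max lexx orbT.
Qed.

Lemma opnorm_ge0 f : 0 <= opnorm f.
Proof.
rewrite (le_trans (rnorm_ge0 (f 0))) //.
apply: (ub_le_sup (opnorm_has_sup f).2).
by exists 0 => //=; rewrite rnorm0 ler01.
Qed.

Lemma le_opnorm (f : bop) u : rnorm (f u) <= opnorm f * rnorm u.
Proof.
have [->|u0] := eqVneq u 0; first by rewrite linear0 !rnorm0 mulr0.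
have u_gt0 : 0 < rnorm u by rewrite -ltcR -rnormE normr_gt0.
rewrite -ler_pdivrMr //.
have cE : complex.Re `|((rnorm u)^-1)%:C| = (rnorm u)^-1.
  by rewrite ger0_norm // ler0c invr_ge0 ltW.
rewrite mulrC -cE -rnormZ -linearZ.
apply: (ub_le_sup (opnorm_has_sup f).2).
by exists (((rnorm u)^-1)%:C *: u) => //=; rewrite rnormZ cE mulVf ?gt_eqF.
Qed.

Lemma opnorm_le (f : bop) (M : R) : 0 <= M ->
  (forall u, rnorm (f u) <= M * rnorm u) -> opnorm f <= M.
Proof.
move=> M0 fM; apply: ge_sup; first exact: (opnorm_has_sup f).1.
by move=> _ [u /= u1 <-]; rewrite (le_trans (fM u)) // ler_piMr.
Qed.

Let norm (f : bop) : R[i] := (opnorm f)%:C.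

Let normD f g : norm (f + g) <= norm f + norm g.
Proof.
rewrite /norm -rmorphD /= lecR; apply: opnorm_le => [|u].
  by rewrite addr_ge0 // opnorm_ge0.
by rewrite (le_trans (rnormD _ _)) // mulrDl lerD // le_opnorm.
Qed.

Let opnormZ_le (a : R[i]) f : opnorm (a *: f) <= complex.Re `|a| * opnorm f.
Proof.
have a0 : 0 <= complex.Re `|a| by rewrite -ler0c RRe_real // ger0_real.
apply: opnorm_le => [|u]; first by rewrite mulr_ge0 ?opnorm_ge0.
by rewrite -[(a *: f) u]/(a *: f u) rnormZ -mulrA ler_wpM2l // le_opnorm.
Qed.

Let norm0_eq0 f : norm f = 0 -> f = 0.
Proof.
move=> /complexI f0; apply: bopP => u.
apply/eqP; rewrite -normr_eq0 rnormE; apply/eqP; congr (_%:C).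
by apply/eqP; rewrite eq_le rnorm_ge0 andbT (le_trans (le_opnorm f u)) // f0 mul0r.
Qed.

Let normZ (a : R[i]) f : norm (a *: f) = `|a| * norm f.
Proof.
have aE (b : R[i]) : `|b| = (complex.Re `|b|)%:C.
  by apply/esym/RRe_real; apply: ger0_real.
suff nE : opnorm (a *: f) = complex.Re `|a| * opnorm f.
  by rewrite aE /norm nE rmorphM.
apply/eqP; rewrite eq_le opnormZ_le andTb.
have [a0|a0] := eqVneq a 0.
  by rewrite a0 [X in complex.Re X]normr0 mul0r opnorm_ge0.
have a_gt0 : 0 < complex.Re `|a| by rewrite -ltcR -aE normr_gt0.
have := opnormZ_le a^-1 (a *: f); rewrite scalerA mulVf // scale1r.
suff -> : complex.Re `|a^-1| = (complex.Re `|a|)^-1.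
  by rewrite mulrC ler_pdivlMr // mulrC.
by apply: complexI; rewrite fmorphV -!aE normfV.
Qed.

HB.instance Definition _ := Lmodule_isNormed.Build R[i] bop normD normZ
  norm0_eq0.

Lemma bop_normE (f : bop) : `|f| = (opnorm f)%:C.
Proof. by []. Qed.

End bounded_operators.

Section bop_complete.
Variables (R : realType) (E : normedModType R[i]).
Variable F : completeNormedModType R[i].
Local Notation B := (bop E F).

Let le_rnorm (V : normedModType R[i]) (v : V) (e : R) :
  (`|v| < e%:C) = (rnorm v < e).
Proof. by rewrite rnormE ltcR. Qed.

Let posC (e : R[i]) : 0 < e -> exists2 r : R, 0 < r & e = r%:C.
Proof.
move=> e0; have eE : (complex.Re e)%:C = e by apply/RRe_real/gtr0_real.
by exists (complex.Re e) => //; rewrite -ltcR eE.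
Qed.

Lemma bop_complete (G : set_system B) : ProperFilter G -> cauchy G -> cvg G.
Proof.
move=> PG /cauchy_ballP cG.
have near2 (e : R) : 0 < e ->
    \forall f \near G & g \near G, opnorm (f - g) < e.
  move=> e0; have /cG : 0 < e%:C by rewrite ltcR.
  by apply: filterS => -[f g] /=; rewrite -ball_normE /= le_rnorm.
have cvgx u : cvg ((fun f : B => f u) @ G).
  apply: cauchy_cvg; apply/cauchy_ballP => e /posC[r r0 ->].
  have d0 : 0 < r / (rnorm u + 1) by rewrite divr_gt0 // ltr_wpDl ?rnorm_ge0.
  have [[P Q] /= [GP GQ] PQ] := near2 _ d0.
  exists ([set f u | f in P], [set f u | f in Q]).
    by split; [apply: filterS GP|apply: filterS GQ] => f ?; exists f.
  move=> [_ _] /= [[f Pf <-] [g Qg <-]].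
  rewrite -ball_normE /= le_rnorm -[f u - g u]/((f - g) u).
  rewrite (le_lt_trans (le_opnorm (f - g) u)) //.
  have /= fg := PQ (f, g) (conj Pf Qg).
  rewrite (@le_lt_trans _ _ (opnorm (f - g) * (rnorm u + 1))) //.
    by rewrite ler_wpM2l ?opnorm_ge0 // lerDl.
  by rewrite -ltr_pdivlMr // ltr_wpDl ?rnorm_ge0.
pose L u : F := lim ((fun f : B => f u) @ G).
have limle (f : B) (e : R) :
    (\forall g \near G, opnorm (f - g) < e) -> forall u, rnorm (f u - L u) <= e * rnorm u.
  move=> fe u; apply/ler_addgt0Pr => r r0.
  have rC : 0 < r%:C by rewrite ltcR.
  have /cvgrPdist_lt/(_ _ rC) Lr := cvgx u.
  have [g [/= fg gL]] := filter_ex (filterI fe Lr).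
  have -> : f u - L u = (f - g) u - (L u - g u).
    by rewrite -[(f - g) u]/(f u - g u) opprB addrA subrK.
  rewrite (le_trans (rnormD _ _)) // lerD //.
    by rewrite (le_trans (le_opnorm (f - g) u)) // ler_wpM2r ?rnorm_ge0 ?ltW.
  by rewrite /rnorm normrN ltW // -le_rnorm.
have Lin : linear L.
  move=> a u v; apply: cvg_lim => //.
  rewrite (_ : (fun f : B => f (a *: u + v)) = (fun f : B => a *: f u + f v)).
    by apply: cvgD; [apply: cvgZl_tmp; exact: cvgx|exact: cvgx].
  by apply/funext => f; rewrite linearP.
have near_le (e : R) : 0 < e ->
    \forall f \near G, forall u, rnorm ((f : B) u - L u) <= e * rnorm u.
  move=> /near2[[P Q] /= [GP GQ] PQ]; apply: filterS GP => f Pf.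
  by apply: limle; apply: filterS GQ => g Qg; exact: (PQ (f, g)).
have Lb : L \in @bounded_linear R E F.
  rewrite inE; split => //; have [f fL] := filter_ex (near_le _ ltr01).
  exists (opnorm f + 1) => u; rewrite mulrDl.
  have -> : L u = f u - (f u - L u) by rewrite opprB addrC subrK.
  rewrite (le_trans (rnormD _ _)) // lerD ?le_opnorm //.
  by rewrite /rnorm normrN; exact: fL.
apply/cvg_ex; exists (Bop Lb); apply/cvgrPdist_lt => e /posC[r r0 ->].
have r2 : 0 < r / 2 by rewrite divr_gt0.
apply: filterS (near_le _ r2) => f fL.
rewrite distrC le_rnorm (@le_lt_trans _ _ (r / 2)) //; last first.
  by rewrite ltr_pdivrMr // ltr_pMr // ltr1n.
by apply: opnorm_le => [|u]; [exact: ltW|exact: fL].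
Qed.

HB.instance Definition _ := Uniform_isComplete.Build B bop_complete.

End bop_complete.

Notation "''L' ( H )" := (bop H H) (at level 8, format "''L' ( H )") : type_scope.

Section hilbert.
Variables (R : realType) (H : completeNormedModType R[i]).

(* The inner product dot induces the norm of H; together with the completeness
   of H this says that (H, dot) is a complex Hilbert space. *)
Definition is_hilbert (dot : {dot H for Num.conj}) :=
  forall u : H, dot u u = `|u| ^+ 2.

Definition separable := exists D : set H, countable D /\ dense D.

Definition psd_op (dot : {dot H for Num.conj}) (T : 'L(H)) :=
  forall u : H, 0 <= dot (T u) u.

End hilbert.

Section bochner_integral.
Context d (T : measurableType d) (R : realType).
Variables (mu : {finite_measure set T -> \bar R}).
Variable E : completeNormedModType R[i].
Implicit Types (f : T -> E) (A : set T).

Definition simple_fun f :=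
  finite_set (range f) /\ forall v, measurable (f @^-1` [set v]).

Definition simple_integral A f : E :=
  \sum_(v \in range f) (fine (mu (A `&` f @^-1` [set v])))%:C *: v.

Definition strongly_measurable f := exists s : (T -> E)^nat,
  (forall n, simple_fun (s n)) /\
  {ae mu, forall t, s n t @[n --> \oo] --> f t}.

Definition bochner_approx f (s : (T -> E)^nat) :=
  (forall n, simple_fun (s n)) /\
  (\int[mu]_t (rnorm (f t - s n t))%:E)%E @[n --> \oo] --> 0%E.

Definition bochner_integrable f :=
  strongly_measurable f /\ exists s, bochner_approx f s.

(* For f Bochner integrable, the limit exists and does not depend on s. *)
Definition bochner_integral A f : E :=
  get [set v | exists s, bochner_approx f s /\
                 simple_integral A (s n) @[n --> \oo] --> v].

End bochner_integral.

Definition complex_integrable d (T : measurableType d) (R : realType)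
    (mu : set T -> \bar R) (h : T -> R[i]) :=
  mu.-integrable setT (fun t => (complex.Re (h t))%:E) /\
  mu.-integrable setT (fun t => (complex.Im (h t))%:E).

Notation borel X := (g_sigma_algebraType (@open X)).

Definition radon (R : realType) (X : ptopologicalType)
    (mu : set (borel X) -> \bar R) :=
  (forall A : set (borel X), measurable A ->
     mu A = ereal_inf [set mu V | V in [set V : set X | open V /\ A `<=` V]]) /\
  (forall V : set X, open V ->
     mu V = ereal_sup [set mu K | K in [set K : set X | compact K /\ K `<=` V]]).

Section operator_valued_measures.
Variables (R : realType) (H : completeNormedModType R[i]).
Variable X : ptopologicalType.
Implicit Types L : set (borel X) -> 'L(H).

(* The families are contained in A rather than partitions of A, so that the
   variation is nonnegative on every set; on a Borel set A both suprema agree,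
   since the complement of the family in A may be added to it. *)
Definition variation L (A : set (borel X)) : \bar R :=
  ereal_sup [set x | exists n (F : 'I_n -> set (borel X)),
    [/\ forall i, measurable (F i), trivIset setT F, \bigcup_i F i `<=` A &
        x = (\sum_(i < n) rnorm (L (F i)))%:E]].

Record radon_psd_measure (dot : {dot H for Num.conj}) L : Prop := {
  ovm_sigma_additive : forall F : (set (borel X))^nat,
    (forall n, measurable (F n)) -> trivIset setT F ->
    (\sum_(0 <= k < n) L (F k)) @[n --> \oo] --> L (\bigcup_n F n) ;
  ovm_bounded_variation : (variation L setT < +oo)%E ;
  ovm_psd : forall A, measurable A -> psd_op dot (L A) ;
  ovm_radon : radon (variation L)
}.

Variable lambda : {finite_measure set (borel X) -> \bar R}.
Variable G : borel X -> 'L(H).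

Definition radon_nikodym_decomposition L :=
  bochner_integrable lambda G /\
  forall A, measurable A -> L A = bochner_integral lambda A G.

Definition ovm_integral (g : borel X -> R[i]) : 'L(H) :=
  bochner_integral lambda setT (fun w => g w *: G w).

Definition ovm_integral_defined L (g : borel X -> R[i]) :=
  complex_integrable (variation L) g /\
  bochner_integrable lambda (fun w => g w *: G w).

End operator_valued_measures.

(* The library derivative needs a domain and a codomain over the same field;
   here the domain is real and the codomain complex. *)
Section partial_derivatives.
Variables (R : realType) (m : nat) (E : normedModType R[i]).
Local Notation V := 'rV[R]_m.
Implicit Types (g : V -> E) (f : V -> V -> E) (a b : 'I_m -> nat).

Definition diff_quotient g (i : 'I_m) (x : V) (h : R) : E :=
  (h%:C)^-1 *: (g (x + h *: delta_mx 0 i) - g x).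

Definition has_partial g i x := cvg (diff_quotient g i x h @[h --> 0^']).

Definition partial g i x : E := lim (diff_quotient g i x h @[h --> 0^']).

Definition multi_order a := (\sum_(i < m) a i)%N.

(* The head of the list is differentiated last (foldr below), so that
   d^a = d_0^(a 0) (d_1^(a 1) (...)). *)
Definition directions a : seq 'I_m :=
  flatten [seq nseq (a i) i | i <- enum 'I_m].

Definition partial1 (i : 'I_m) f : V -> V -> E :=
  fun x y => partial (f^~ y) i x.
Definition partial2 (i : 'I_m) f : V -> V -> E :=
  fun x y => partial (f x) i y.

(* d_1^a d_2^b f: the derivatives in the second variable are taken first. *)
Definition mixed_partial a b f : V -> V -> E :=
  foldr partial1 (foldr partial2 f (directions b)) (directions a).

Fixpoint has_partials1 (U : set V) (s : seq 'I_m) f : Prop :=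
  if s is i :: s' then has_partials1 U s' f /\
    forall x y, U x -> U y -> has_partial ((foldr partial1 f s')^~ y) i x
  else True.

Fixpoint has_partials2 (U : set V) (s : seq 'I_m) f : Prop :=
  if s is i :: s' then has_partials2 U s' f /\
    forall x y, U x -> U y -> has_partial (foldr partial2 f s' x) i y
  else True.

Definition has_mixed_partial (U : set V) a b f :=
  has_partials2 U (directions b) f /\
  has_partials1 U (directions a) (foldr partial2 f (directions b)).

Definition Cclass (U : set V) (r s : nat) f :=
  forall a b, (multi_order a <= r)%N -> (multi_order b <= s)%N ->
    has_mixed_partial U a b f /\
    {within U `*` U, continuous (fun z : V * V => mixed_partial a b f z.1 z.2)}.

Definition C0class (X : topologicalType) (U : set V) (r s : nat)
    (p : X -> V -> V -> E) :=
  forall a b, (multi_order a <= r)%N -> (multi_order b <= s)%N ->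
    (forall w, has_mixed_partial U a b (p w)) /\
    {within setT `*` (U `*` U), continuous
       (fun z : X * (V * V) => mixed_partial a b (p z.1) z.2.1 z.2.2)}.

End partial_derivatives.

Definition positive_definite_kernel (R : realType) (V : Type) (U : set V)
    (k : V -> V -> R[i]) :=
  forall n (x : 'I_n -> V) (c : 'I_n -> R[i]),
    injective x -> (forall i, U (x i)) ->
    0 <= \sum_(i < n) \sum_(j < n) c i * (c j)^* * k (x i) (x j).

Definition dominated (R : realType) (X : ptopologicalType) (m : nat)
    (U : set 'rV[R]_m) (q : nat) (sigma : set (borel X) -> \bar R)
    (p : X -> 'rV[R]_m -> 'rV[R]_m -> R[i]^o) :=
  exists h : borel X -> R[i], complex_integrable sigma h /\
    forall (w : X) x y (a b : 'I_m -> nat), U x -> U y ->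
      (multi_order a <= q)%N -> (multi_order b <= q)%N ->
      `|mixed_partial a b (p w) x y| <= `|h w|.

(* Main.v *)
From HB Require Import structures.
From mathcomp Require Import finmap measurable_realfun ring lra.
Require Import Defs.

(** The integral of g against dLambda = G dlambda is the Bochner integral of g *: G
    for lambda, and the statement is differentiation under this integral.

    The kernel p is dominated by a function h that is integrable for the variation
    of Lambda, whereas the integrals are taken for lambda. The two are linked by
    d|Lambda| = |G| dlambda ([variationE]): on the fibres of a simple function close
    to G, the norm of Lambda is almost the integral of |G|. Hence the integral of
    |h| |G| for lambda is finite ([integral_variation], [dominating_norm_lty]). This
    makes all the integrals defined and gives a dominated convergence theorem for
    them ([ovm_integral_cvg]). It rests on the elementary theory of the Bochner
    integral over a finite measure: a strongly measurable function agrees off a null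
    set with an everywhere limit of simple functions, such a function of integrable
    norm is approximated in mean by simple functions ([bochner_measurable_approx]),
    and the integrals of these converge to a limit that does not depend on the
    approximation ([simple_integral_cvg]).

    Dominated convergence gives the continuity of P a b directly. For its
    derivatives, the mean value inequality bounds the difference quotients of a
    derivative of p by the next derivative, hence by h ([ovm_integral_has_dir]). So
    the partial derivative number i of P a b in the second variable is P a (b + e_i),
    and similarly in the first variable, provided that this holds for the derivatives
    of p. Since mixed partial derivatives are taken in a prescribed order, this is a
    matter of commuting derivatives of which only one order is known to exist.
    Schwarz's theorem in the form that deduces the existence of the other order
    ([schwarz]) allows a new derivative to be moved to its place one step at a time
    ([has_dir_insert]).

    Once the P a b are known to form a family closed under partial derivatives, their
    mixed partial derivatives are again members of the family
    ([closed_family_mixed_partial]), and the claims follow. *)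

Set Implicit Arguments.
Unset Strict Implicit.
Unset Printing Implicit Defensive.

Local Open Scope classical_set_scope.
Local Open Scope ring_scope.
Local Open Scope complex_scope.

(** * Simple functions and their integrals *)

Section simple_maps.
Context d (T : measurableType d).
Implicit Types K L : Type.

Definition simple_map K (f : T -> K) :=
  finite_set (range f) /\ forall v, measurable (f @^-1` [set v]).

Lemma simple_map_preimage K (f : T -> K) B :
  simple_map f -> measurable (f @^-1` B).
Proof.
move=> [ff mf]; have -> : f @^-1` B = \bigcup_(v in range f `&` B) f @^-1` [set v].
  apply/seteqP; split=> [t Bt|t [v [_ Bv] /= ->] //].
  by exists (f t) => //; split=> //; exists t.
by apply: fin_bigcup_measurable => //; apply: finite_setIl.
Qed.

Lemma simple_map_comp K L (phi : K -> L) (f : T -> K) :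
  simple_map f -> simple_map (fun t => phi (f t)).
Proof.
move=> sf; split=> [|v]; last exact: (simple_map_preimage (phi @^-1` [set v]) sf).
have -> : range (fun t => phi (f t)) = phi @` range f.
  apply/seteqP; split=> [_ [t _ <-]|_ [_ [t _ <-] <-]]; last by exists t.
  by exists (f t) => //; exists t.
by apply: finite_image; case: sf.
Qed.

Lemma simple_map_pair K L (f : T -> K) (g : T -> L) :
  simple_map f -> simple_map g -> simple_map (fun t => (f t, g t)).
Proof.
move=> [ff mf] [fg mg]; split=> [|[u v]].
  apply: (sub_finite_set _ (finite_setX ff fg)) => _ [t _ <-].
  by split; exists t.
have -> : (fun t => (f t, g t)) @^-1` [set (u, v)] = f @^-1` [set u] `&` g @^-1` [set v].
  by apply/seteqP; split=> [t [/= <- <-]//|t [/= <- <-]].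
exact: measurableI.
Qed.

Lemma simple_map_cst K (v : K) : simple_map (cst v : T -> K).
Proof.
split; first exact: finite_image_cst.
move=> u; case: (pselect (v = u)) => [->|vu].
  by rewrite (_ : _ @^-1` _ = setT) //; apply/seteqP; split.
by rewrite (_ : _ @^-1` _ = set0) //; apply/seteqP; split.
Qed.

Lemma simple_map_bool (A : set T) : measurable A -> simple_map (fun t => t \in A).
Proof.
move=> mA; split=> [|b]; first exact: finite_finset.
case: b; have E : forall b, (fun t => t \in A) @^-1` [set b] = [set t | (t \in A) = b] by [].
- suff -> : (fun t => t \in A) @^-1` [set true] = A by [].
  by apply/seteqP; split=> t /=; [move/set_mem|move/mem_set].
- suff -> : (fun t => t \in A) @^-1` [set false] = ~` A by apply: measurableC.
  by apply/seteqP; split=> t /=; [move/negbT; rewrite notin_setE|move=> At; apply: memNset].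
Qed.

Lemma simple_map_measurable K d' (L : measurableType d') (phi : K -> L) (f : T -> K) :
  simple_map f -> measurable_fun setT (fun t => phi (f t)).
Proof.
move=> sf _ Y mY; rewrite setTI.
exact: (simple_map_preimage Y (simple_map_comp phi sf)).
Qed.

End simple_maps.

Section rnorm_more.
Variables (R : realType) (E : normedModType R[i]).
Implicit Types u v : E.

Lemma rnormN u : rnorm (- u) = rnorm u.
Proof. by rewrite /rnorm normrN. Qed.

Lemma rnormB u v : rnorm (u - v) = rnorm (v - u).
Proof. by rewrite -rnormN opprB. Qed.

Lemma rnorm_le_sub u v : rnorm u <= rnorm v + rnorm (u - v).
Proof. by rewrite -{1}(subrK v u) addrC rnormD. Qed.

Lemma rnorm_triangle u v w : rnorm (u - w) <= rnorm (u - v) + rnorm (v - w).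
Proof. by rewrite -{1}(subrK v u) -addrA rnormD. Qed.

Lemma rnorm_sum (I : Type) (r : seq I) (F : I -> E) :
  rnorm (\sum_(i <- r) F i) <= \sum_(i <- r) rnorm (F i).
Proof.
elim/big_rec2: _ => [|i y1 y2 _ h]; first by rewrite rnorm0.
by rewrite (le_trans (rnormD _ _)) // lerD2l.
Qed.

Lemma rnormZR (a : R) u : rnorm (a%:C *: u) = `|a| * rnorm u.
Proof. by rewrite rnormZ normc_def /= expr0n /= addr0 sqrtr_sqr. Qed.

Lemma rnorm_dist u v : `|rnorm u - rnorm v| <= rnorm (u - v).
Proof.
rewrite ler_norml; apply/andP; split.
  by rewrite lerNl opprB lerBlDl rnormB rnorm_le_sub.
by rewrite lerBlDl rnorm_le_sub.
Qed.

Lemma rnorm_eq0 u : (rnorm u == 0) = (u == 0).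
Proof. by rewrite -[RHS]normr_eq0 rnormE (inj_eq (@complexI R) _ 0). Qed.

Lemma cvg_rnormP (T : Type) (F : set_system T) {FF : Filter F} (f : T -> E) l :
  f @ F --> l <-> forall e : R, 0 < e -> \forall t \near F, rnorm (l - f t) < e.
Proof.
split=> [/cvgrPdist_lt h e e0|h].
  have := h e%:C; rewrite ltcR => /(_ e0).
  by apply: filterS => t; rewrite rnormE ltcR.
apply/cvgrPdist_lt => e e0.
have eE : (complex.Re e)%:C = e by apply/RRe_real/gtr0_real.
have r0 : 0 < complex.Re e by rewrite -ltcR eE.
by apply: filterS (h _ r0) => t; rewrite rnormE -[in X in _ -> X]eE ltcR.
Qed.

Lemma cvg_rnorm (T : Type) (F : set_system T) {FF : Filter F} (f : T -> E) l :
  f @ F --> l -> rnorm (f t) @[t --> F] --> rnorm l.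
Proof.
move=> /cvg_rnormP h; apply/cvgrPdist_lt => e e0.
by apply: filterS (h _ e0) => t; apply: le_lt_trans; apply: rnorm_dist.
Qed.

Lemma cvg_rnorm_le (T : Type) (F : set_system T) {FF : ProperFilter F} (f : T -> E) l c M :
  f @ F --> l -> (\forall t \near F, rnorm (f t - c) <= M) -> rnorm (l - c) <= M.
Proof.
move=> /cvg_rnormP h hM; apply/ler_addgt0Pr => e e0.
have [t [/= h1 h2]] := filter_ex (filterI hM (h _ e0)).
by rewrite (le_trans (rnorm_triangle l (f t) c)) // addrC lerD // ltW.
Qed.

End rnorm_more.

Section complex_rnorm.
Variable R : realType.
Implicit Types z : R[i]^o.

Lemma rnorm_complex z :
  rnorm z = Num.sqrt (complex.Re z ^+ 2 + complex.Im z ^+ 2).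
Proof. by case: z => a b. Qed.

Lemma rnorm_le_Re_Im z : rnorm z <= `|complex.Re z| + `|complex.Im z|.
Proof.
rewrite rnorm_complex -[leRHS](ger0_norm (addr_ge0 (normr_ge0 _) (normr_ge0 _))).
rewrite -sqrtr_sqr; apply: ler_wsqrtr.
rewrite [leRHS]sqrrD !real_normK ?num_real // -addrA lerD2l lerDr mulrn_wge0 //.
Qed.

Lemma normr_Re_le z : `|complex.Re z| <= rnorm z.
Proof. by rewrite rnorm_complex -sqrtr_sqr; apply: ler_wsqrtr; rewrite lerDl sqr_ge0. Qed.

Lemma normr_Im_le z : `|complex.Im z| <= rnorm z.
Proof. by rewrite rnorm_complex -sqrtr_sqr; apply: ler_wsqrtr; rewrite lerDr sqr_ge0. Qed.

End complex_rnorm.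

Section simple_integral.
Context d (T : measurableType d) (R : realType).
Variables (mu : {finite_measure set T -> \bar R}).
Variable E : completeNormedModType R[i].
Implicit Types (f g : T -> E) (A : set T).

Let m A : R := fine (mu A).

Lemma fine_measure_fin_bigcup (I : choiceType) (D : set I) (F : I -> set T) :
  finite_set D -> trivIset D F -> (forall i, D i -> measurable (F i)) ->
  m (\bigcup_(i in D) F i) = \sum_(i \in D) m (F i).
Proof.
move=> fD tF mF; rewrite /m measure_fin_bigcup //.
have -> : (\sum_(i \in D) mu (F i))%E = (\sum_(i \in D) (fine (mu (F i)))%:E)%E.
  by apply: eq_fsbigr => i /set_mem Di; rewrite fineK ?fin_num_measure//; exact: mF.
by rewrite fsumEFin.
Qed.

Lemma trivIset_fibers (K : Type) (k : T -> K) A D :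
  trivIset D (fun u => A `&` k @^-1` [set u]).
Proof. by move=> i j _ _ [t [[_ /= <-] [_ /= <-]]]. Qed.

(** The fibres of k refine those of phi o k, and additivity of the measure
    regroups the terms. With the pair of two simple functions as k, linearity of
    the simple integral becomes linearity of one finite sum. *)
Lemma simple_integralE (K : choiceType) (k : T -> K) (phi : K -> E) A :
  measurable A -> simple_map k ->
  simple_integral mu A (fun t => phi (k t)) =
  \sum_(u \in range k) (m (A `&` k @^-1` [set u]))%:C *: phi u.
Proof.
move=> mA sk; have [fk mk] := sk; have [ff mf] := simple_map_comp phi sk.
set f := fun t => phi (k t) in ff mf *; rewrite /simple_integral.
have step v : (m (A `&` f @^-1` [set v]))%:C *: v =
    \sum_(u \in range k)
      (if phi u == v then (m (A `&` k @^-1` [set u]))%:C *: phi u else 0).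
  have -> : A `&` f @^-1` [set v] =
      \bigcup_(u in range k `&` [set u | phi u = v]) (A `&` k @^-1` [set u]).
    apply/seteqP; split=> [t [At /= ftv]|t [u [_ /= <-] [At /= kt]]].
      by exists (k t) => //; split=> //; exists t.
    by split=> //=; rewrite /f kt.
  rewrite fine_measure_fin_bigcup; last 3 first.
  - exact: finite_setIl.
  - exact: trivIset_fibers.
  - by move=> u _; apply: measurableI.
  transitivity (\sum_(u \in range k `&` [set u | phi u = v])
      (m (A `&` k @^-1` [set u]))%:C *: v).
    rewrite !fsbig_finite; [|exact: finite_setIl..].
    by rewrite rmorph_sum scaler_suml.
  rewrite fsbig_mkcondr; apply: eq_fsbigr => u _; rewrite /patch.
  case: ifPn => [/set_mem /= ->|]; first by rewrite eqxx.
  by rewrite notin_setE /=; case: eqP.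
under eq_fsbigr do rewrite step.
rewrite exchange_fsbig //; apply: eq_fsbigr => u /set_mem [t _ ktu].
have phit : range f (phi u) by exists t => //; rewrite /f ktu.
rewrite (fsbigD1 (phi u)) //= eqxx fsbig1 ?addr0 // => v [_ /= vu].
by case: eqP => // e; case: vu.
Qed.

Lemma simple_integralB A f g : measurable A -> simple_map f -> simple_map g ->
  simple_integral mu A (fun t => f t - g t) =
  simple_integral mu A f - simple_integral mu A g.
Proof.
move=> mA sf sg; have sp := simple_map_pair sf sg; have [fp _] := sp.
rewrite (simple_integralE (fun u : E * E => u.1 - u.2) mA sp).
rewrite (simple_integralE (fun u : E * E => u.1) mA sp).
rewrite (simple_integralE (fun u : E * E => u.2) mA sp).
rewrite !fsbig_finite //= -sumrB; apply: eq_bigr => u _.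
by rewrite scalerBr.
Qed.

Lemma simple_integralZ A c f : measurable A -> simple_map f ->
  simple_integral mu A (fun t => c *: f t) = c *: simple_integral mu A f.
Proof.
move=> mA sf; have [ff _] := sf.
rewrite (simple_integralE (fun u => c *: u) mA sf) /simple_integral.
rewrite !fsbig_finite // scaler_sumr; apply: eq_bigr => u _.
by rewrite !scalerA mulrC.
Qed.

Lemma integral_rnorm_simple A f : measurable A -> simple_map f ->
  (\int[mu]_(t in A) (rnorm (f t))%:E)%E =
  (\sum_(v \in range f) m (A `&` f @^-1` [set v]) * rnorm v)%:E.
Proof.
move=> mA sf; have [ff mf] := sf.
have E1 t : (rnorm (f t))%:E =
    (\sum_(v \in range f) (rnorm v)%:E * (\1_(f @^-1` [set v]) t)%:E)%E.
  rewrite (fsbigD1 (f t)) //=; last by exists t.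
  rewrite indicE mem_set // mule1 fsbig1 ?adde0 // => v [_ /= vu].
  by rewrite indicE memNset ?mule0 //= => e; apply: vu.
under eq_integral do rewrite E1.
rewrite ge0_integral_fsum //; last 2 first.
- move=> v; apply: measurable_funeM; apply/measurable_EFinP.
  exact: measurable_indic.
- by move=> v t _; rewrite -EFinM lee_fin mulr_ge0 ?rnorm_ge0 // indicE ler0n.
rewrite -fsumEFin //; apply: eq_fsbigr => v _.
rewrite ge0_integralZl_EFin ?rnorm_ge0 //; last first.
  by apply/measurable_EFinP; exact: measurable_indic.
rewrite integral_indic // muleC setIC EFinM; congr (_ * _)%E.
by rewrite fineK // fin_num_measure //; apply: measurableI.
Qed.

Lemma rnorm_simple_integral A f : measurable A -> simple_map f ->
  ((rnorm (simple_integral mu A f))%:E <= \int[mu]_(t in A) (rnorm (f t))%:E)%E.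
Proof.
move=> mA sf; have [ff mf] := sf; rewrite integral_rnorm_simple // lee_fin.
rewrite /simple_integral !fsbig_finite //= (le_trans (rnorm_sum _ _)) //.
apply: ler_sum => v _; rewrite rnormZR ger0_norm //.
exact/fine_ge0/measure_ge0.
Qed.

End simple_integral.

(** * Measurability of functions with values in a normed module *)

Section null_sets.
Context d (T : measurableType d) (R : realType).
Variable mu : {measure set T -> \bar R}.
Import HBNNSimple.
Local Open Scope ereal_scope.

(** The integral of a nonnegative function, measurable or not, is a supremum over
    the simple functions below it, and a simple function may be set to 0 on N
    without changing its integral. A strongly measurable function is only almost
    everywhere equal to a measurable one, whence the generality. *)
Lemma ge0_integral_eq_off (N : set T) (f g : T -> \bar R) :
  measurable N -> mu N = 0 -> (forall t, 0 <= f t) -> (forall t, 0 <= g t) ->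
  (forall t, ~ N t -> f t = g t) -> \int[mu]_t f t = \int[mu]_t g t.
Proof.
move=> mN N0.
suff le : forall f g : T -> \bar R, (forall t, 0 <= f t) -> (forall t, 0 <= g t) ->
    (forall t, ~ N t -> f t = g t) -> \int[mu]_t f t <= \int[mu]_t g t.
  move=> f0 g0 fg; apply/eqP; rewrite eq_le !le //.
  by move=> t Nt; rewrite fg.
move=> {}f {}g f0 g0 fg; rewrite !ge0_integralTE //.
apply: ge_ereal_sup => _ [h /= hf <-].
pose h' := proj_nnsfun h (measurableC mN).
have -> : sintegral mu h = sintegral mu h'.
  rewrite -!integralT_nnsfun; apply: ge0_ae_eq_integral => //.
  - by apply/measurable_EFinP; exact: measurable_funPT.
  - by apply/measurable_EFinP; exact: measurable_funPT.
  - by move=> t _; rewrite lee_fin; exact: fun_ge0.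
  - by move=> t _; rewrite lee_fin; exact: fun_ge0.
  exists N; split=> // t /=; apply: contra_notP => Nt _.
  by rewrite mindicE mem_set ?mulr1.
apply: ereal_sup_ubound; exists h' => //= t; rewrite mindicE.
have [tN|tN] := boolP (t \in ~` N); rewrite ?mulr0 ?mulr1 //.
by rewrite -fg ?hf //; move/set_mem: tN.
Qed.

End null_sets.

Section bochner_measurable.
Import HBSimple.
Context d (T : measurableType d) (R : realType).
Implicit Types E : normedModType R[i].

(** Everywhere limits of simple functions. Strong measurability with respect to
    a measure allows an exceptional null set, off which the function may be
    arbitrary; replacing it by 0 there gives a function of this kind, all of whose
    norms are measurable. *)
Definition bochner_measurable E (f : T -> E) := exists s : (T -> E)^nat,
  (forall n, simple_map (s n)) /\ forall t, s n t @[n --> \oo] --> f t.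

Lemma simple_bochner_measurable E (f : T -> E) : simple_map f -> bochner_measurable f.
Proof. by move=> sf; exists (fun=> f); split=> // t; apply: cvg_cst. Qed.

Lemma bochner_measurable_rnorm E (f : T -> E) : bochner_measurable f ->
  measurable_fun setT (fun t => rnorm (f t)).
Proof.
move=> [s [ss sf]].
apply: (@measurable_fun_cvg _ _ _ _ (fun n t => rnorm (s n t))).
  by move=> n; apply: (simple_map_measurable (@rnorm R E) (ss n)).
by move=> t _; apply: cvg_rnorm; apply: sf.
Qed.

Lemma bochner_measurable_ernorm E (f : T -> E) A : measurable A -> bochner_measurable f ->
  measurable_fun A (fun t => (rnorm (f t))%:E).
Proof.
by move=> mA mf; apply/measurable_EFinP/measurable_funTS/bochner_measurable_rnorm.
Qed.

Lemma bochner_measurableB E (f g : T -> E) :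
  bochner_measurable f -> bochner_measurable g ->
  bochner_measurable (fun t => f t - g t).
Proof.
move=> [s [ss sf]] [u [su ug]]; exists (fun n t => s n t - u n t); split=> [n|t].
  exact: (simple_map_comp (fun x : E * E => x.1 - x.2) (simple_map_pair (ss n) (su n))).
by apply: cvgB.
Qed.

Lemma bochner_measurable_scale E (g : T -> R[i]^o) (f : T -> E) :
  bochner_measurable g -> bochner_measurable f ->
  bochner_measurable (fun t => g t *: f t).
Proof.
move=> [s [ss sf]] [u [su ug]]; exists (fun n t => s n t *: u n t); split=> [n|t].
  exact: (simple_map_comp (fun x : R[i]^o * E => x.1 *: x.2)
    (simple_map_pair (ss n) (su n))).
by apply: cvgZ.
Qed.

Lemma bochner_measurableZ E (c : R[i]) (f : T -> E) : bochner_measurable f ->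
  bochner_measurable (fun t => c *: f t).
Proof.
apply: (@bochner_measurable_scale _ (cst c)).
by apply: simple_bochner_measurable; exact: simple_map_cst.
Qed.

(** The real and the imaginary part are limits of real simple functions. *)
Lemma bochner_measurable_complex (g : T -> R[i]^o) :
  measurable_fun setT (fun t => complex.Re (g t)) ->
  measurable_fun setT (fun t => complex.Im (g t)) -> bochner_measurable g.
Proof.
move=> /measurable_EFinP mR /measurable_EFinP mI.
have [r rg] := approximation_sfun measurableT mR.
have [j jg] := approximation_sfun measurableT mI.
have sf (h : {sfun T >-> R}) : simple_map h.
  by split; [exact: fimfunP|move=> v; exact: measurable_funPTI].
exists (fun n t => (r n t) +i* (j n t)); split=> [n|t].
  exact: (simple_map_comp (fun x : R * R => x.1 +i* x.2)
    (simple_map_pair (sf (r n)) (sf (j n)))).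
apply/cvg_rnormP => e e0.
have e2 : 0 < e / 2 by rewrite divr_gt0.
have /fine_cvgP[_ /cvgrPdist_lt/(_ _ e2) hr] := rg t Logic.I.
have /fine_cvgP[_ /cvgrPdist_lt/(_ _ e2) hj] := jg t Logic.I.
apply: filterS2 hr hj => n /= hr hj.
rewrite [e]splitr; apply: le_lt_trans (ltrD hr hj).
have := rnorm_le_Re_Im (g t - ((r n t) +i* (j n t) : R[i]^o)).
by case: (g t).
Qed.

End bochner_measurable.

(** * The Bochner integral over a finite measure *)

Section bochner.
Context d (T : measurableType d) (R : realType).
Variables (mu : {finite_measure set T -> \bar R}).
Variable E : completeNormedModType R[i].
Implicit Types (f g : T -> E) (A : set T).

(** Both the function and its approximations are set to 0 on the exceptional set. *)
Lemma strongly_measurable_modification f : strongly_measurable mu f ->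
  exists N f', [/\ measurable N, mu N = 0%E, bochner_measurable f' &
    forall t, ~ N t -> f t = f' t].
Proof.
move=> [s [ss [N [mN N0 sN]]]].
exists N, (fun t => if t \in N then 0 else f t); split=> //; last first.
  by move=> t Nt; rewrite memNset.
exists (fun n t => if t \in N then 0 else s n t); split=> [n|t].
  exact: (simple_map_comp (fun x : bool * E => if x.1 then 0 else x.2)
    (simple_map_pair (simple_map_bool mN) (ss n))).
have [tN|tN] := boolP (t \in N); first exact: cvg_cst.
apply: contrapT => /sN Nt; move: tN; rewrite notin_setE; exact.
Qed.

(** Approximations, hence integrals, ignore null sets; all that follows may
    therefore be proved for everywhere limits of simple functions. *)
Section modification.
Variables (N : set T) (f f' : T -> E).
Hypotheses (mN : measurable N) (N0 : mu N = 0%E).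
Hypothesis ff' : forall t, ~ N t -> f t = f' t.

Lemma bochner_approx_eq_off : bochner_approx mu f = bochner_approx mu f'.
Proof.
apply/funext => s; rewrite /bochner_approx.
suff -> : (fun n => \int[mu]_t (rnorm (f t - s n t))%:E)%E =
          (fun n => \int[mu]_t (rnorm (f' t - s n t))%:E)%E by [].
apply/funext => n; apply: (ge0_integral_eq_off mN N0).
- by move=> t; rewrite lee_fin rnorm_ge0.
- by move=> t; rewrite lee_fin rnorm_ge0.
- by move=> t Nt; rewrite ff'.
Qed.

Lemma bochner_integral_eq_off A : bochner_integral mu A f = bochner_integral mu A f'.
Proof. by rewrite /bochner_integral bochner_approx_eq_off. Qed.

End modification.

Local Notation norm_int A f := (\int[mu]_(t in A) (rnorm (f t))%:E)%E.

Lemma norm_int_ge0 A f : (0 <= norm_int A f)%E.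
Proof. by apply: integral_ge0 => t _; rewrite lee_fin rnorm_ge0. Qed.

Lemma norm_int_subset A f : measurable A -> bochner_measurable f ->
  (norm_int A f <= norm_int setT f)%E.
Proof.
move=> mA mf; apply: ge0_subset_integral => //.
- exact: bochner_measurable_ernorm.
- by move=> t _; rewrite lee_fin rnorm_ge0.
Qed.

Lemma norm_int_leD A (F G H : normedModType R[i]) (f : T -> F) (g : T -> G) (h : T -> H) :
  measurable A -> bochner_measurable f -> bochner_measurable g -> bochner_measurable h ->
  (forall t, A t -> rnorm (f t) <= rnorm (g t) + rnorm (h t)) ->
  (norm_int A f <= norm_int A g + norm_int A h)%E.
Proof.
move=> mA mf mg mh le; rewrite -ge0_integralD //; last 4 first.
- by move=> t _; rewrite lee_fin rnorm_ge0.
- exact: bochner_measurable_ernorm.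
- by move=> t _; rewrite lee_fin rnorm_ge0.
- exact: bochner_measurable_ernorm.
apply: ge0_le_integral => //.
- by move=> t _; rewrite lee_fin rnorm_ge0.
- exact: bochner_measurable_ernorm.
- by apply: emeasurable_funD; exact: bochner_measurable_ernorm.
Qed.

(** The simple functions s n that converge to f need not converge in mean. Cut off
    where their norm exceeds twice the one of f, they still converge to f, and
    dominated convergence applies to the errors, with bound 3 |f|. *)
Lemma bochner_measurable_approx f : bochner_measurable f ->
  (norm_int setT f < +oo)%E -> exists s, bochner_approx mu f s.
Proof.
move=> mf foo; have [s [ss sf]] := mf.
have mr := bochner_measurable_rnorm mf.
pose B n := [set t | rnorm (s n t) <= 2 * rnorm (f t)].
have mB n : measurable (B n).
  have -> : B n = setT `&` (fun t => 2 * rnorm (f t) - rnorm (s n t)) @^-1` `[0, +oo[.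
    by rewrite setTI; apply/seteqP; split=> t; rewrite /B /= in_itv /= andbT subr_ge0.
  have : measurable_fun setT (fun t => 2 * rnorm (f t) - rnorm (s n t)).
    apply: measurable_funB; first exact: measurable_funM.
    exact: (simple_map_measurable (@rnorm R E) (ss n)).
  by apply; [exact: measurableT|exact: measurable_itv].
pose u n t := if t \in B n then s n t else 0.
have su n : simple_map (u n).
  exact: (simple_map_comp (fun x : bool * E => if x.1 then x.2 else 0)
    (simple_map_pair (simple_map_bool (mB n)) (ss n))).
have u_le n t : rnorm (f t - u n t) <= 3 * rnorm (f t).
  have -> : 3 * rnorm (f t) = rnorm (f t) + 2 * rnorm (f t) by ring.
  rewrite (le_trans (rnormD _ _)) // lerD2l rnormN /u.
  by case: ifPn => [/set_mem //|_]; rewrite rnorm0 mulr_ge0 ?rnorm_ge0.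
have u_cvg t : u n t @[n --> \oo] --> f t.
  have [f0|f0] := eqVneq (f t) 0.
    rewrite f0; apply: cvg_near_cst; apply: nearW => n; rewrite /u.
    case: ifPn => // /set_mem; rewrite /B /= f0 rnorm0 mulr0 => s0.
    by apply/eqP; rewrite -rnorm_eq0 eq_le s0 rnorm_ge0.
  have f_gt0 : 0 < rnorm (f t) by rewrite lt_neqAle eq_sym rnorm_eq0 f0 rnorm_ge0.
  have /cvg_rnormP h := sf t.
  apply/cvg_rnormP => e e0.
  near=> n; suff -> : u n t = s n t by near: n; exact: h.
  rewrite /u mem_set // /B /=.
  have : rnorm (f t - s n t) < rnorm (f t) by near: n; exact: h.
  have := rnorm_le_sub (s n t) (f t); rewrite rnormB; lra.
exists u; split=> //.
have := @dominated_convergence _ _ _ mu setT measurableT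
  (fun n t => (rnorm (f t - u n t))%:E) (cst 0%E) (fun t => (3 * rnorm (f t))%:E).
case=> //.
- move=> n; apply: bochner_measurable_ernorm => //.
  by apply: bochner_measurableB => //; exact: simple_bochner_measurable.
- apply: aeW => t _; apply: cvg_EFin; first exact: nearW.
  rewrite -[X in _ --> X](@rnorm0 R E) -[in X in _ --> X](subrr (f t)).
  by apply: cvg_rnorm; apply: cvgB => //; exact: cvg_cst.
- apply/integrableP; split.
    by apply/measurable_EFinP; exact: measurable_funM.
  under eq_integral do rewrite /= ger0_norm ?mulr_ge0 ?rnorm_ge0 // EFinM.
  rewrite ge0_integralZl_EFin //; first exact: lte_mul_pinfty.
  + by move=> t _; rewrite lee_fin rnorm_ge0.
  + exact: bochner_measurable_ernorm.
- by apply: aeW => t n _; rewrite /= lee_fin ger0_norm ?rnorm_ge0.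
move=> _ + _; apply: cvg_trans; apply: near_eq_cvg; apply: nearW => n.
by apply: eq_integral => t _ /=; rewrite subr0 ger0_norm ?rnorm_ge0.
Unshelve. all: end_near. Qed.

Lemma bochner_approx_simple f s : bochner_approx mu f s -> forall n, simple_map (s n).
Proof. by case. Qed.

Lemma bochner_integrable_intro N f f' : measurable N -> mu N = 0%E ->
  (forall t, ~ N t -> f t = f' t) -> bochner_measurable f' ->
  (norm_int setT f' < +oo)%E -> bochner_integrable mu f.
Proof.
move=> mN N0 ff' mf' foo; split; last first.
  by rewrite (bochner_approx_eq_off mN N0 ff'); exact: bochner_measurable_approx.
have [s [ss sf]] := mf'; exists s; split=> //.
by exists N; split=> // t /=; apply: contra_notP => Nt; rewrite ff'.
Qed.

Lemma simple_norm_int_lty (s : T -> E) : simple_map s -> (norm_int setT s < +oo)%E.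
Proof. by move=> ss; rewrite integral_rnorm_simple // ltry. Qed.

Lemma bochner_approx_norm_int_lty f s : bochner_measurable f ->
  bochner_approx mu f s -> (norm_int setT f < +oo)%E.
Proof.
move=> mf [ss /fine_cvgP[[n _ h] _]].
have hn : norm_int setT (fun t => f t - s n t) \is a fin_num := h n (leqnn n).
have ms := simple_bochner_measurable (ss n).
apply: (@le_lt_trans _ _ (norm_int setT (fun t => f t - s n t) + norm_int setT (s n))%E).
  apply: norm_int_leD => //; first exact: bochner_measurableB.
  by move=> t _; rewrite addrC rnorm_le_sub.
apply: lte_add_pinfty; first by rewrite ltey_eq hn.
exact: (simple_norm_int_lty (ss n)).
Qed.

Lemma simple_integral_dist A f s s' : measurable A -> bochner_measurable f ->
  simple_map s -> simple_map s' ->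
  ((rnorm (simple_integral mu A s - simple_integral mu A s'))%:E <=
   norm_int A (fun t => f t - s t) + norm_int A (fun t => f t - s' t))%E.
Proof.
move=> mA mf ss ss'; have ms := simple_bochner_measurable ss.
have ms' := simple_bochner_measurable ss'.
rewrite -simple_integralB //; apply: le_trans (rnorm_simple_integral _ mA _) _.
  exact: (simple_map_comp (fun x : E * E => x.1 - x.2) (simple_map_pair ss ss')).
apply: norm_int_leD => //; try exact: bochner_measurableB.
by move=> t _; rewrite (rnormB (f t)) rnorm_triangle.
Qed.

Lemma bochner_approx_near f s e : bochner_approx mu f s -> 0 < e ->
  \forall n \near \oo, (norm_int setT (fun t => f t - s n t)%R < e%:E)%E.
Proof.
move=> [ss /fine_cvgP[h1 /cvgrPdist_lt h2]] e0.
apply: filterS2 h1 (h2 _ e0) => n /= fin; rewrite sub0r normrN => h.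
by rewrite -(fineK fin) lte_fin; apply: le_lt_trans h; exact: ler_norm.
Qed.

Lemma simple_integral_near A f s s' e : measurable A -> bochner_measurable f ->
  bochner_approx mu f s -> bochner_approx mu f s' -> 0 < e ->
  exists n0, forall n n', (n0 <= n)%N -> (n0 <= n')%N ->
   rnorm (simple_integral mu A (s n) - simple_integral mu A (s' n')) < e.
Proof.
move=> mA mf sf sf' e0; have e2 : 0 < e / 2 by rewrite divr_gt0.
have [n _ hn] := bochner_approx_near sf e2.
have [n' _ hn'] := bochner_approx_near sf' e2.
have ss := bochner_approx_simple sf; have ss' := bochner_approx_simple sf'.
exists (maxn n n') => k k'; rewrite !geq_max => /andP[nk _] /andP[_ nk'].
rewrite -lte_fin (splitr e) EFinD.
apply: le_lt_trans (simple_integral_dist mA mf (ss k) (ss' k')) _.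
apply: lteD.
  apply: le_lt_trans (hn _ nk); apply: norm_int_subset => //.
  by apply: bochner_measurableB => //; exact: simple_bochner_measurable.
apply: le_lt_trans (hn' _ nk'); apply: norm_int_subset => //.
by apply: bochner_measurableB => //; exact: simple_bochner_measurable.
Qed.

(** By [simple_integral_near] the simple integrals along two approximations are
    close to each other. With equal approximations this is the Cauchy property and
    gives a limit; with different ones it shows that the limit is unique, so that
    the limit chosen in the definition is the one at hand. *)
Lemma simple_integral_cvg A f s : measurable A -> bochner_measurable f ->
  bochner_approx mu f s ->
  simple_integral mu A (s n) @[n --> \oo] --> bochner_integral mu A f.
Proof.
move=> mA mf sf.
have [v sv] : exists v : E, simple_integral mu A (s n) @[n --> \oo] --> v.
  apply/cvg_ex.
  apply: cauchy_cvg; apply/cauchy_ballP => e e0.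
  have eE : (complex.Re e)%:C = e by apply/RRe_real/gtr0_real.
  have r0 : 0 < complex.Re e by rewrite -ltcR eE.
  have [n0 h] := simple_integral_near mA mf sf sf r0.
  exists ([set simple_integral mu A (s n) | n in [set n | (n0 <= n)%N]],
          [set simple_integral mu A (s n) | n in [set n | (n0 <= n)%N]]).
    by split; exists n0 => // n /= hn; exists n.
  move=> [_ _] /= [[n hn <-] [n' hn' <-]].
  by rewrite -ball_normE /= rnormE -[in X in _ < X]eE ltcR h.
suff : [set v | exists s, bochner_approx mu f s /\
    simple_integral mu A (s n) @[n --> \oo] --> v] (bochner_integral mu A f).
  move=> [s' [sf' sv']]; suff -> : bochner_integral mu A f = v by [].
  apply/eqP; rewrite -subr_eq0 -rnorm_eq0 eq_le rnorm_ge0 andbT.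
  apply/ler_addgt0Pr => e e0; rewrite add0r.
  have [n0 h] := simple_integral_near mA mf sf' sf e0.
  apply: (cvg_rnorm_le sv'); exists n0 => // n' /= hn'.
  rewrite rnormB; apply: (cvg_rnorm_le sv); exists n0 => // n /= hn.
  by rewrite rnormB ltW // h.
by rewrite /bochner_integral; apply: getPex; exists v, s.
Qed.

(** Passage to the limit in [simple_integral_dist]. For s = 0 this is the triangle
    inequality for the integral; for general s it compares a vector measure with
    density f to one whose total variation can be read off. *)
Lemma bochner_integral_dist A f s : measurable A -> bochner_measurable f ->
  (norm_int setT f < +oo)%E -> simple_map s ->
  ((rnorm (bochner_integral mu A f - simple_integral mu A s))%:E <=
   norm_int A (fun t => f t - s t)%R)%E.
Proof.
move=> mA mf foo ss; have [u uf] := bochner_measurable_approx mf foo.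
have su := bochner_approx_simple uf.
apply/lee_addgt0Pr => e e0.
have mfs g : simple_map g -> bochner_measurable (fun t => f t - g t).
  by move=> sg; apply: bochner_measurableB => //; exact: simple_bochner_measurable.
have fin : norm_int A (fun t => f t - s t) \is a fin_num.
  rewrite ge0_fin_numE ?norm_int_ge0 //.
  apply: le_lt_trans (norm_int_subset mA (mfs _ ss)) _.
  apply: (@le_lt_trans _ _ (norm_int setT f + norm_int setT s)%E).
    apply: norm_int_leD => //; [exact: mfs|exact: simple_bochner_measurable|].
    by move=> t _; rewrite (le_trans (rnormD _ _)) // rnormN.
  by rewrite lte_add_pinfty // simple_norm_int_lty.
rewrite -(fineK fin) -EFinD lee_fin.
apply: (cvg_rnorm_le (simple_integral_cvg mA mf uf)).
apply: filterS (bochner_approx_near uf e0) => n hn.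
rewrite -lee_fin EFinD fineK //.
rewrite (le_trans (simple_integral_dist mA mf (su n) ss)) // addeC leeD2l //.
by apply: le_trans (norm_int_subset mA (mfs _ (su n))) (ltW hn).
Qed.

Lemma simple_integral0 A : measurable A -> simple_integral mu A (cst 0) = 0 :> E.
Proof.
move=> mA; have := simple_integralB mu mA (simple_map_cst T (0 : E)) (simple_map_cst T (0 : E)).
rewrite subrr (_ : (fun t : T => cst 0 t - cst 0 t) = cst 0) //.
by apply/funext => t /=; rewrite subr0.
Qed.

Lemma rnorm_bochner_integral A f : measurable A -> bochner_measurable f ->
  (norm_int setT f < +oo)%E ->
  ((rnorm (bochner_integral mu A f))%:E <= norm_int A f)%E.
Proof.
move=> mA mf foo; have := bochner_integral_dist mA mf foo (simple_map_cst T (0 : E)).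
rewrite simple_integral0 // subr0; congr (_ <= _)%E.
by apply: eq_integral => t _; rewrite subr0.
Qed.

Lemma bochner_approxB f g s u : bochner_measurable f -> bochner_measurable g ->
  bochner_approx mu f s -> bochner_approx mu g u ->
  bochner_approx mu (fun t => f t - g t) (fun n t => s n t - u n t).
Proof.
move=> mf mg sf ug.
have ss := bochner_approx_simple sf; have su := bochner_approx_simple ug.
move: sf ug => [_ sf] [_ ug].
have sm n : simple_map (fun t => s n t - u n t).
  exact: (simple_map_comp (fun x : E * E => x.1 - x.2) (simple_map_pair (ss n) (su n))).
split=> //; apply: (@squeeze_cvge _ _ _ _ (cst 0%E) _
    (fun n => norm_int setT (fun t => f t - s n t) + norm_int setT (fun t => g t - u n t))%E).
- apply: nearW => n; apply/andP; split.
    exact: (norm_int_ge0 setT (fun t => f t - g t - (s n t - u n t))).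
  apply: (@norm_int_leD setT E E E (fun t => f t - g t - (s n t - u n t))) => //.
  + apply: bochner_measurableB; first exact: bochner_measurableB.
    exact: simple_bochner_measurable (sm n).
  + exact: bochner_measurableB mf (simple_bochner_measurable (ss n)).
  + exact: bochner_measurableB mg (simple_bochner_measurable (su n)).
  + move=> t _; rewrite -(rnormN (g t - u n t)).
    have -> : f t - g t - (s n t - u n t) = (f t - s n t) + - (g t - u n t).
      by rewrite !opprB addrACA [RHS]addrACA; congr (_ + _); rewrite addrC.
    exact: rnormD.
- exact: cvg_cst.
- by rewrite -[X in _ --> X](adde0 0%E); apply: cvgeD.
Qed.

Lemma bochner_approxZ c f s : bochner_measurable f -> bochner_approx mu f s ->
  bochner_approx mu (fun t => c *: f t) (fun n t => c *: s n t).
Proof.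
move=> mf sf; have ss := bochner_approx_simple sf; case: sf => _ sf.
split=> [n|]; first exact: (simple_map_comp _ (ss n)).
have -> : (fun n => \int[mu]_t (rnorm (c *: f t - c *: s n t))%:E)%E =
    (fun n => (complex.Re `|c|)%:E * norm_int setT (fun t => f t - s n t))%E.
  apply/funext => n; rewrite -ge0_integralZl_EFin //.
  - by apply: eq_integral => t _; rewrite -scalerBr rnormZ EFinM.
  - by move=> t _; rewrite lee_fin rnorm_ge0.
  - apply: bochner_measurable_ernorm => //.
    exact: bochner_measurableB mf (simple_bochner_measurable (ss n)).
  - exact: (@rnorm_ge0 R R[i]^o c).
by rewrite -[X in _ --> X](mule0 (complex.Re `|c|)%:E); apply: cvgeZl.
Qed.

Lemma bochner_integralB A f g : measurable A ->
  bochner_measurable f -> bochner_measurable g ->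
  (norm_int setT f < +oo)%E -> (norm_int setT g < +oo)%E ->
  bochner_integral mu A (fun t => f t - g t) =
  bochner_integral mu A f - bochner_integral mu A g.
Proof.
move=> mA mf mg foo goo.
have [s sf] := bochner_measurable_approx mf foo.
have [u ug] := bochner_measurable_approx mg goo.
have := simple_integral_cvg mA (bochner_measurableB mf mg) (bochner_approxB mf mg sf ug).
move=> h; apply: (cvg_unique (@norm_hausdorff _ E) h).
have -> : (fun n => simple_integral mu A (fun t => s n t - u n t)) =
    (fun n => simple_integral mu A (s n) - simple_integral mu A (u n)).
  by apply/funext => n; rewrite simple_integralB //;
    [exact: bochner_approx_simple sf n|exact: bochner_approx_simple ug n].
by apply: cvgB; exact: simple_integral_cvg.
Qed.

Lemma bochner_integralZ A c f : measurable A ->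
  bochner_measurable f -> (norm_int setT f < +oo)%E ->
  bochner_integral mu A (fun t => c *: f t) = c *: bochner_integral mu A f.
Proof.
move=> mA mf foo; have [s sf] := bochner_measurable_approx mf foo.
have := simple_integral_cvg mA (bochner_measurableZ c mf) (bochner_approxZ c mf sf).
move=> h; apply: (cvg_unique (@norm_hausdorff _ E) h).
have -> : (fun n => simple_integral mu A (fun t => c *: s n t)) =
    (fun n => c *: simple_integral mu A (s n)).
  by apply/funext => n; rewrite simple_integralZ //; exact: bochner_approx_simple sf n.
by apply: cvgZl_tmp; exact: simple_integral_cvg.
Qed.

End bochner.

(** * The variation of a measure with a Bochner density *)

Section density.
Context d (T : measurableType d) (R : realType).
Variables (mu : {measure set T -> \bar R}) (k : T -> R).
Hypotheses (mk : measurable_fun setT k) (k0 : forall t, 0 <= k t).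
Import HBNNSimple.

Let mek A : measurable_fun A (fun t => (k t)%:E).
Proof. by apply/measurable_EFinP/measurable_funTS. Qed.

Let nu A : \bar R := (\int[mu]_(t in A) (k t)%:E)%E.

Let nu0 : nu set0 = 0%E.
Proof. exact: integral_set0. Qed.

Let nu_ge0 A : (0 <= nu A)%E.
Proof. by apply: integral_ge0 => t _; rewrite lee_fin. Qed.

Let nu_sigma_additive : semi_sigma_additive nu.
Proof.
move=> F mF tF mUF; rewrite /nu ge0_integral_bigcup //; last first.
  by move=> t _; rewrite lee_fin.
by apply: is_cvg_ereal_nneg_natsum => n _; apply: nu_ge0.
Qed.

HB.instance Definition _ := isMeasure.Build _ _ _ nu nu0 nu_ge0 nu_sigma_additive.

Let integral_nnsfun_density (h : {nnsfun T >-> R}) :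
  sintegral nu h = (\int[mu]_t (h t * k t)%:E)%E.
Proof.
rewrite sintegralE.
have E1 t : (h t * k t)%:E =
    (\sum_(v \in range h) v%:E * ((fun s => (k s)%:E) \_ (h @^-1` [set v])) t)%E.
  rewrite (fsbigD1 (h t)) //=; last by exists t.
  rewrite patchE mem_set // fsbig1 ?adde0 // => v [_ /= vu].
  by rewrite patchE memNset ?mule0 //= => e; apply: vu.
under [RHS]eq_integral do rewrite E1.
have mh v : measurable (h @^-1` [set v]) by exact: measurable_funPTI.
have mkh v : measurable_fun setT ((fun s => (k s)%:E) \_ (h @^-1` [set v])).
  by apply/(measurable_restrictT _ (mh v)).
have kh0 v t : (0 <= ((fun s => (k s)%:E) \_ (h @^-1` [set v])) t)%E.
  by rewrite patchE; case: ifP => // _; rewrite lee_fin.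
rewrite ge0_integral_fsum //; last 2 first.
- by move=> v; apply: measurable_funeM.
- move=> v t _; rewrite patchE; case: ifPn => [/set_mem <-|_]; last by rewrite mule0.
  by apply: mule_ge0; rewrite lee_fin; [exact: fun_ge0|exact: k0].
apply: eq_fsbigr => v /set_mem [t _ <-].
have ht0 : 0 <= h t by exact: fun_ge0.
rewrite ge0_integralZl_EFin //.
by rewrite -integral_mkcond.
Qed.

(** Only the values of rho on measurable sets enter its integrals, and there rho
    is the measure with density k. For simple f the identity is additivity; the
    general case follows by monotone convergence. *)
Lemma integral_density (rho : set T -> \bar R) (f : T -> R) :
  (forall A, measurable A -> rho A = \int[mu]_(t in A) (k t)%:E)%E ->
  measurable_fun setT f -> (forall t, 0 <= f t) ->
  (\int[rho]_t (f t)%:E = \int[mu]_t (f t * k t)%:E)%E.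
Proof.
move=> rhoE mf f0.
have -> : (\int[rho]_t (f t)%:E = \int[nu]_t (f t)%:E)%E.
  rewrite /integral; congr (ereal_sup _ - ereal_sup _)%E; apply/seteqP;
  split=> _ [h hf <-]; exists h => //; rewrite !sintegralET; apply: eq_fsbigr => x _;
  by rewrite rhoE //; exact: measurable_funPTI.
have mef : measurable_fun setT (EFin \o f) by apply/measurable_EFinP.
have cvgh := cvg_nnsfun_approx measurableT mef.
have ndh := nd_nnsfun_approx measurableT mef.
set h := nnsfun_approx measurableT mef in cvgh ndh.
have f0' : forall t, setT t -> (0 <= (EFin \o f) t)%E by move=> t _; rewrite lee_fin.
have h1 : (\int[nu]_t (h n t)%:E)%E @[n --> \oo] --> (\int[nu]_t (f t)%:E)%E.
  have -> : (\int[nu]_t (f t)%:E = \int[nu]_t limn (fun n => (h n t)%:E))%E.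
    by apply: eq_integral => t _; apply/esym/cvg_lim => //; exact: cvgh.
  apply: cvg_monotone_convergence => //.
  - by move=> n; apply/measurable_EFinP; exact: measurable_funPT.
  - by move=> n t _; rewrite lee_fin; exact: fun_ge0.
  - by move=> t _ n m nm; rewrite lee_fin; exact/lefP/ndh.
have h2 : (\int[mu]_t (h n t * k t)%:E)%E @[n --> \oo] --> (\int[mu]_t (f t * k t)%:E)%E.
  have -> : (\int[mu]_t (f t * k t)%:E = \int[mu]_t limn (fun n => (h n t * k t)%:E))%E.
    apply: eq_integral => t _; apply/esym/cvg_lim => //.
    rewrite EFinM; under eq_fun do rewrite EFinM.
    by apply: cvgeZr => //; exact: cvgh.
  apply: cvg_monotone_convergence => //.
  - move=> n; apply/measurable_EFinP; apply: measurable_funM => //.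
  - by move=> n t _; rewrite lee_fin mulr_ge0 //; exact: fun_ge0.
  - by move=> t _ n m nm; rewrite lee_fin ler_wpM2r //; exact/lefP/ndh.
apply: (cvg_unique (@ereal_hausdorff R) h1).
suff -> : (fun n => \int[nu]_t (h n t)%:E)%E =
  (fun n => \int[mu]_t (h n t * k t)%:E)%E by [].
by apply/funext => n; rewrite integralT_nnsfun integral_nnsfun_density.
Qed.

End density.

Section variation.
Variables (R : realType) (H : completeNormedModType R[i]) (X : ptopologicalType).
Variable lambda : {finite_measure set (borel X) -> \bar R}.
Variables (L : set (borel X) -> 'L(H)) (G : borel X -> 'L(H)).
Hypotheses (mG : bochner_measurable G)
  (Goo : (\int[lambda]_w (rnorm (G w))%:E < +oo)%E)
  (LE : forall A, measurable A -> L A = bochner_integral lambda A G).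

Local Notation norm_int A f := (\int[lambda]_(t in A) (rnorm (f t))%:E)%E.

Lemma norm_int_partition n (F : 'I_n -> set (borel X)) (f : borel X -> 'L(H)) :
  (forall i, measurable (F i)) -> trivIset setT F -> bochner_measurable f ->
  (norm_int (\bigcup_i F i) f = \sum_(i < n) norm_int (F i) f)%E.
Proof.
move=> mF tF mf.
have -> : \bigcup_i F i = \big[setU/set0]_(i <- index_enum 'I_n) F i.
  rewrite -bigcup_seq; apply: eq_bigcupl.
  by split=> i _ //=; rewrite mem_index_enum.
rewrite ge0_integral_bigsetU ?index_enum_uniq //.
- exact: (sub_trivIset (@subsetT _ _) tF).
- apply: bochner_measurable_ernorm => //.
  exact: bigsetU_measurable.
- by move=> t _; rewrite lee_fin rnorm_ge0.
Qed.

Lemma variation_le A : measurable A -> (variation L A <= norm_int A G)%E.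
Proof.
move=> mA; apply: ge_ereal_sup => _ [n [F [mF tF FA ->]]].
apply: (@le_trans _ _ (norm_int (\bigcup_i F i) G)).
  rewrite norm_int_partition // -sumEFin; apply: lee_sum => i _.
  by rewrite LE //; exact: rnorm_bochner_integral.
apply: ge0_subset_integral => //.
- exact: fin_bigcup_measurable.
- exact: bochner_measurable_ernorm.
- by move=> t _; rewrite lee_fin rnorm_ge0.
Qed.

(** On a fibre of s inside A the integral of |s| is the norm of the integral of s,
    and both L and |G| differ from the corresponding integrals of s by at most the
    integral of |G - s|. *)
Lemma variation_ge_simple A (s : borel X -> 'L(H)) : measurable A -> simple_map s ->
  (norm_int A G <= variation L A + (norm_int setT (fun w => (G w - s w)%R) +
    norm_int setT (fun w => (G w - s w)%R)))%E.
Proof.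
move=> mA ss; have ms := simple_bochner_measurable ss.
have mGs := bochner_measurableB mG ms.
pose r : seq 'L(H) := enum_fset (fset_set (range s)); have [fs mfib] := ss.
pose F (i : 'I_(size r)) := A `&` s @^-1` [set nth 0 r i].
have mF i : measurable (F i) by apply: measurableI.
have tF : trivIset setT F.
  move=> i j _ _ [w [[_ /= wi] [_ /= wj]]]; apply/val_inj/eqP.
  rewrite -(@nth_uniq _ 0 r) ?ltn_ord // -?wi -?wj //; exact: fset_uniq.
have UF : \bigcup_i F i = A.
  apply/seteqP; split=> [w [i _ []] //|w Aw].
  have sr : s w \in r.
    have : s w \in fset_set (range s) by rewrite in_fset_set // inE; exists w.
    by [].
  have lt : (index (s w) r < size r)%N by rewrite index_mem.
  by exists (Ordinal lt) => //; split=> //=; rewrite nth_index.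
rewrite -{1}UF norm_int_partition //.
have step i : (norm_int (F i) G <= (rnorm (L (F i)))%:E +
    (norm_int (F i) (fun w => (G w - s w)%R) + norm_int (F i) (fun w => (G w - s w)%R)))%E.
  apply: (@le_trans _ _ (norm_int (F i) s + norm_int (F i) (fun w => (G w - s w)%R)))%E.
    by apply: norm_int_leD => // t _; rewrite rnorm_le_sub.
  rewrite [leRHS]addeA; apply: leeD => //.
  set v := nth 0 r i.
  have sFi : simple_integral lambda (F i) s = (fine (lambda (F i)))%:C *: v.
    have [F0|/set0P[w0 [Aw0 sw0]]] := eqVneq (F i) set0.
      rewrite /simple_integral F0 measure0 scale0r fsbig1 // => u _.
      by rewrite set0I measure0 scale0r.
    rewrite /simple_integral (fsbigD1 v) //=; last by exists w0.
    rewrite [X in lambda X](_ : _ = F i); last first.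
      by apply/seteqP; split=> [w []//|w Fw]; split=> //; case: Fw.
    rewrite fsbig1 ?addr0 // => u [_ /= uv].
    rewrite (_ : F i `&` _ = set0) ?measure0 ?scale0r //.
    by apply/seteqP; split=> // w [[_ /= sw] /= su]; apply: uv; rewrite -su sw.
  have -> : norm_int (F i) s = (rnorm (simple_integral lambda (F i) s))%:E.
    rewrite sFi rnormZR ger0_norm ?fine_ge0 // EFinM fineK ?fin_num_measure //.
    rewrite muleC -integral_cst //; apply: eq_integral => w /set_mem [_ /= ->] //.
  apply: (@le_trans _ _ ((rnorm (L (F i)))%:E +
      (rnorm (L (F i) - simple_integral lambda (F i) s))%:E)%E).
    by rewrite -EFinD lee_fin rnormB rnorm_le_sub.
  by apply: leeD2l; rewrite LE //; exact: bochner_integral_dist.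
apply: le_trans; first by apply: lee_sum => i _; exact: step.
have errE := norm_int_partition mF tF mGs; rewrite UF in errE.
rewrite big_split /=; apply: leeD.
  by rewrite sumEFin; apply: ereal_sup_ubound; exists (size r), F; split=> //; rewrite UF.
by rewrite big_split; apply: leeD; rewrite -[leLHS]errE; exact: norm_int_subset.
Qed.

(** The variation of G dlambda is |G| dlambda: letting the simple functions of an
    approximation of G grow, the error in [variation_ge_simple] vanishes. *)
Lemma variationE A : measurable A -> variation L A = norm_int A G.
Proof.
move=> mA; apply/eqP; rewrite eq_le variation_le //=.
have [s sG] := bochner_measurable_approx mG Goo.
apply/lee_addgt0Pr => e e0; have e2 : 0 < e / 2 by rewrite divr_gt0.
have [n hn] := filter_ex (bochner_approx_near sG e2).
apply: (le_trans (variation_ge_simple mA (bochner_approx_simple sG n))).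
by rewrite leeD2l // (splitr e) EFinD leeD // ltW.
Qed.

Lemma integral_variation (f : borel X -> R) :
  measurable_fun setT f -> (forall w, 0 <= f w) ->
  (\int[variation L]_w (f w)%:E = \int[lambda]_w (f w * rnorm (G w))%:E)%E.
Proof.
move=> mf f0; apply: integral_density => //.
- exact: bochner_measurable_rnorm.
- by move=> w; exact: rnorm_ge0.
- exact: variationE.
Qed.

End variation.

(** * Dominated convergence for the operator valued measure *)

Section sequential_limits.
Variables (R : realType) (E : normedModType R[i]) (T : pseudoMetricType R).
Implicit Types (x : T) (D : set T).

Lemma within_ball_nbhs x D (n : nat) :
  within D (nbhs x) (ball x n.+1%:R^-1 `&` D).
Proof.
have : nbhs x (ball x n.+1%:R^-1) by apply: nbhsx_ballx.
by apply: filterS => y ? ?.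
Qed.

Lemma within_ball_basis x D (A : set T) : within D (nbhs x) A ->
  \forall n \near \oo, ball x n.+1%:R^-1 `&` D `<=` A.
Proof.
move=> /nbhs_ballP[e /= e0 xA].
have : n.+1%:R^-1 @[n --> \oo] --> (0 : R) by exact: cvg_harmonic.
move=> /cvgrPdist_lt/(_ _ e0); apply: filterS => n /=.
rewrite sub0r normrN ger0_norm // => /ltW le y [xy Dy].
by apply: xA => //; exact: le_ball le _ xy.
Qed.

(** The limits to be taken under the integral are limits along real parameters or
    points of U x U, whereas dominated convergence concerns sequences. *)
Lemma cvg_within_seq x D (f : T -> E) (l : E) :
  (forall z : nat -> T, (forall n, D (z n)) -> z n @[n --> \oo] --> x ->
     f (z n) @[n --> \oo] --> l) ->
  f y @[y --> within D (nbhs x)] --> l.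
Proof.
move=> fl; apply/cvg_rnormP => e e0; apply: contrapT => nF.
have /choice[z Bz] : forall n, exists y, (ball x n.+1%:R^-1 `&` D) y /\
    e <= rnorm (l - f y).
  move=> n; apply: contrapT => nex; apply: nF.
  apply: filterS (within_ball_nbhs x D n) => y By; rewrite ltNge; apply/negP => h.
  by apply: nex; exists y.
have zx : z n @[n --> \oo] --> x.
  move=> A xA; have := @within_ball_basis x D A.
  have wA : within D (nbhs x) A by apply: filterS xA.
  by move=> /(_ wA); apply: filterS => n h; apply: h; case: (Bz n).
have /cvg_rnormP/(_ _ e0) [n _ h] := fl z (fun n => (Bz n).1.2) zx.
by have := h n (leqnn n); rewrite /= ltNge (Bz n).2.
Qed.

End sequential_limits.

Section ovm_integral.
Variables (R : realType) (H : completeNormedModType R[i]) (X : ptopologicalType).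
Variable lambda : {finite_measure set (borel X) -> \bar R}.
Variables (L : set (borel X) -> 'L(H)) (G : borel X -> 'L(H)).
Hypothesis LG : radon_nikodym_decomposition lambda G L.
Variable h : borel X -> R[i]^o.
Hypothesis h_int : complex_integrable (variation L) h.

Lemma rnorm_scale (c : R[i]^o) (u : 'L(H)) : rnorm (c *: u) = rnorm c * rnorm u.
Proof. exact: rnormZ. Qed.

Definition dominated_by (g : borel X -> R[i]^o) :=
  bochner_measurable g /\ forall w, rnorm (g w) <= rnorm (h w).

Lemma radon_nikodym_modification : exists N G', [/\ measurable N,
  lambda N = 0%E, bochner_measurable G', (forall w, ~ N w -> G w = G' w) &
  (\int[lambda]_w (rnorm (G' w))%:E < +oo)%E].
Proof.
have [[sG [s sG']] _] := LG.
have [N [G' [mN N0 mG' GG']]] := strongly_measurable_modification sG.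
exists N, G'; split=> //; apply: (bochner_approx_norm_int_lty mG' (s := s)).
by rewrite -(bochner_approx_eq_off mN N0 GG').
Qed.

Section modification.
Variables (N : set (borel X)) (G' : borel X -> 'L(H)).
Hypotheses (mN : measurable N) (N0 : lambda N = 0%E) (mG' : bochner_measurable G')
  (GG' : forall w, ~ N w -> G w = G' w)
  (Goo : (\int[lambda]_w (rnorm (G' w))%:E < +oo)%E).

Let LE A : measurable A -> L A = bochner_integral lambda A G'.
Proof. move=> mA; rewrite (LG.2 A mA); exact: (bochner_integral_eq_off mN N0 GG'). Qed.

Lemma dominating_measurable : bochner_measurable h.
Proof.
case: h_int => /integrableP[/measurable_EFinP mR _] /integrableP[/measurable_EFinP mI _].
exact: bochner_measurable_complex.
Qed.

(** The domination is by a function integrable for |L|. As |L| = |G'| lambda, this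
    bounds the integral of |h| |G'| for lambda. *)
Lemma dominating_norm_lty : (\int[lambda]_w (rnorm (h w *: G' w))%:E < +oo)%E.
Proof.
case: h_int => /integrableP[/measurable_EFinP mR R_lty].
move=> /integrableP[/measurable_EFinP mI I_lty].
have mRa : measurable_fun setT (fun w => `|complex.Re (h w)|) by exact: measurableT_comp.
have mIa : measurable_fun setT (fun w => `|complex.Im (h w)|) by exact: measurableT_comp.
have mrG := bochner_measurable_rnorm mG'.
apply: (@le_lt_trans _ _ (\int[lambda]_w ((`|complex.Re (h w)| * rnorm (G' w))%:E +
    (`|complex.Im (h w)| * rnorm (G' w))%:E)))%E.
  apply: ge0_le_integral => //.
  - by move=> w _; rewrite lee_fin rnorm_ge0.
  - apply: bochner_measurable_ernorm => //.
    exact: bochner_measurable_scale dominating_measurable mG'.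
  - by apply: emeasurable_funD; apply/measurable_EFinP; exact: measurable_funM.
  - move=> w _; rewrite -EFinD lee_fin rnorm_scale -mulrDl ler_wpM2r ?rnorm_ge0 //.
    exact: rnorm_le_Re_Im.
rewrite ge0_integralD //; last 4 first.
- by move=> w _; rewrite lee_fin mulr_ge0 // rnorm_ge0.
- by apply/measurable_EFinP; exact: measurable_funM.
- by move=> w _; rewrite lee_fin mulr_ge0 // rnorm_ge0.
- by apply/measurable_EFinP; exact: measurable_funM.
rewrite -(integral_variation mG' Goo LE) // -(integral_variation mG' Goo LE) //.
exact: lte_add_pinfty.
Qed.

Lemma dominated_scale_measurable g : dominated_by g ->
  bochner_measurable (fun w => g w *: G' w).
Proof. by case=> mg _; exact: bochner_measurable_scale. Qed.

Lemma dominated_norm_lty g : dominated_by g ->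
  (\int[lambda]_w (rnorm (g w *: G' w))%:E < +oo)%E.
Proof.
move=> dg; apply: le_lt_trans dominating_norm_lty; apply: ge0_le_integral => //.
- by move=> w _; rewrite lee_fin rnorm_ge0.
- exact: bochner_measurable_ernorm (dominated_scale_measurable dg).
- apply: bochner_measurable_ernorm => //.
  exact: bochner_measurable_scale dominating_measurable mG'.
- by move=> w _; rewrite lee_fin !rnorm_scale ler_wpM2r ?rnorm_ge0 //; case: dg.
Qed.

Lemma ovm_integral_modification g :
  ovm_integral lambda G g = ovm_integral lambda G' g.
Proof.
by apply: (bochner_integral_eq_off mN N0) => w Nw; rewrite GG'.
Qed.

(** The identity |L| = |G'| lambda is used here in the other direction: |g| |G'| is
    integrable for lambda, hence g is integrable for |L|. *)
Lemma dominated_integral_defined g : dominated_by g ->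
  ovm_integral_defined lambda G L g.
Proof.
move=> dg; split; last first.
  apply: (bochner_integrable_intro mN N0 _ (dominated_scale_measurable dg)).
  - by move=> w Nw; rewrite GG'.
  - exact: dominated_norm_lty.
have [[s [ss sg]] gh] := dg.
have part (f : R[i]^o -> R) : (forall z, `|f z| <= rnorm z) ->
    (forall z z', f (z - z') = f z - f z') ->
    (variation L).-integrable setT (fun w => (f (g w))%:E).
  move=> fle fB.
  have mf : measurable_fun setT (fun w => f (g w)).
    apply: (@measurable_fun_cvg _ _ _ _ (fun n w => f (s n w))).
      by move=> n; exact: simple_map_measurable (ss n).
    move=> w _; apply/cvgrPdist_lt => e e0.
    have /cvg_rnormP/(_ _ e0) := sg w.
    by apply: filterS => n; apply: le_lt_trans; rewrite -fB.
  have mfa : measurable_fun setT (fun w => `|f (g w)|) by exact: measurableT_comp.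
  apply/integrableP; split; first exact/measurable_EFinP.
  rewrite [X in (X < _)%E](_ : _ = \int[variation L]_w (`|f (g w)|)%:E)%E //.
  rewrite (integral_variation mG' Goo LE) //.
  apply: le_lt_trans (dominated_norm_lty dg); apply: ge0_le_integral => //.
  - by move=> w _; rewrite lee_fin mulr_ge0 // rnorm_ge0.
  - apply/measurable_EFinP; apply: measurable_funM => //.
    exact: bochner_measurable_rnorm.
  - exact: bochner_measurable_ernorm (dominated_scale_measurable dg).
  - by move=> w _; rewrite lee_fin rnorm_scale ler_wpM2r ?rnorm_ge0.
split; apply: part.
- exact: normr_Re_le.
- by move=> [a b] [c e].
- exact: normr_Im_le.
- by move=> [a b] [c e].
Qed.

Lemma ovm_integralB g1 g2 : dominated_by g1 -> dominated_by g2 ->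
  ovm_integral lambda G (fun w => g1 w - g2 w) =
  ovm_integral lambda G g1 - ovm_integral lambda G g2.
Proof.
move=> d1 d2; rewrite !ovm_integral_modification /ovm_integral.
rewrite -(bochner_integralB measurableT (dominated_scale_measurable d1)
  (dominated_scale_measurable d2) (dominated_norm_lty d1) (dominated_norm_lty d2)).
by congr (bochner_integral _ _ _); apply/funext => w; rewrite scalerBl.
Qed.

Lemma ovm_integralZB (c : R[i]) g1 g2 : dominated_by g1 -> dominated_by g2 ->
  ovm_integral lambda G (fun w => c *: (g1 w - g2 w)) =
  c *: (ovm_integral lambda G g1 - ovm_integral lambda G g2).
Proof.
move=> d1 d2; rewrite -ovm_integralB // !ovm_integral_modification /ovm_integral.
have mB : bochner_measurable (fun w => (g1 w - g2 w) *: G' w).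
  exact: bochner_measurable_scale (bochner_measurableB d1.1 d2.1) mG'.
rewrite -(bochner_integralZ c measurableT mB).
  by congr (bochner_integral _ _ _); apply/funext => w; rewrite -scalerA.
apply: (@le_lt_trans _ _ (\int[lambda]_w (rnorm (g1 w *: G' w))%:E +
   \int[lambda]_w (rnorm (g2 w *: G' w))%:E))%E.
  apply: (norm_int_leD _ measurableT mB (dominated_scale_measurable d1)
    (dominated_scale_measurable d2)).
  by move=> w _; rewrite scalerBl (le_trans (rnormD _ _)) // rnormN.
by apply: lte_add_pinfty; exact: dominated_norm_lty.
Qed.

(** The norm of the difference of the integrals is at most the integral of
    |g0 - g n| |G'|, to which scalar dominated convergence applies with the bound
    2 |h| |G'|. *)
Lemma ovm_integral_cvg_seq (g : nat -> borel X -> R[i]^o) g0 :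
  (forall n, dominated_by (g n)) -> dominated_by g0 ->
  (forall w, g n w @[n --> \oo] --> g0 w) ->
  ovm_integral lambda G (g n) @[n --> \oo] --> ovm_integral lambda G g0.
Proof.
move=> dg dg0 gg0; apply/cvg_rnormP => e e0.
have := @dominated_convergence _ _ _ lambda setT measurableT
  (fun n w => (rnorm ((g0 w - g n w) *: G' w))%:E) (cst 0%E)
  (fun w => (rnorm (h w *: G' w) + rnorm (h w *: G' w))%:E).
have mdiff n : bochner_measurable (fun w => (g0 w - g n w) *: G' w).
  exact: bochner_measurable_scale (bochner_measurableB dg0.1 (dg n).1) mG'.
have mhG := bochner_measurable_scale dominating_measurable mG'.
case=> //.
- by move=> n; exact: bochner_measurable_ernorm.
- apply: aeW => w _; apply: cvg_EFin; first exact: nearW.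
  rewrite -[X in _ --> X](@rnorm0 R 'L(H)) -(scale0r (G' w)) -(subrr (g0 w)).
  apply: cvg_rnorm; apply: cvgZr_tmp; apply: cvgB => //; exact: cvg_cst.
- apply/integrableP; split.
    apply/measurable_EFinP; apply: measurable_funD; exact: bochner_measurable_rnorm.
  rewrite [X in (X < _)%E](_ : _ =
    \int[lambda]_w ((rnorm (h w *: G' w))%:E + (rnorm (h w *: G' w))%:E))%E.
    rewrite ge0_integralD //; last 4 first.
    + by move=> w _; rewrite lee_fin rnorm_ge0.
    + exact: bochner_measurable_ernorm.
    + by move=> w _; rewrite lee_fin rnorm_ge0.
    + exact: bochner_measurable_ernorm.
    by apply: lte_add_pinfty; exact: dominating_norm_lty.
  by apply: eq_integral => w _; rewrite /= ger0_norm // addr_ge0 // rnorm_ge0.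
- apply: aeW => w n _; rewrite /= lee_fin ger0_norm ?rnorm_ge0 //.
  rewrite scalerBl (le_trans (rnormD _ _)) // rnormN !rnorm_scale.
  by rewrite lerD // ler_wpM2r ?rnorm_ge0 //; [case: dg0|case: (dg n)].
move=> _ _; rewrite integral0 => /fine_cvgP[fin /cvgrPdist_lt/(_ _ e0)].
apply: filterS2 fin => n fin; rewrite /= sub0r normrN => lt.
rewrite -ovm_integralB // ovm_integral_modification -lte_fin.
have fin' : (\int[lambda]_w (rnorm ((g0 w - g n w) *: G' w))%:E)%E \is a fin_num.
  exact: fin.
apply: (@le_lt_trans _ _ (\int[lambda]_w (rnorm ((g0 w - g n w) *: G' w))%:E)%E).
  by apply: (rnorm_bochner_integral measurableT (mdiff n)); rewrite ltey_eq fin'.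
by rewrite -(fineK fin') lte_fin; apply: le_lt_trans lt; exact: ler_norm.
Qed.

End modification.

Lemma ovm_integral_definedP g : dominated_by g -> ovm_integral_defined lambda G L g.
Proof.
have [N [G' [mN N0 mG' GG' Goo]]] := radon_nikodym_modification.
exact: dominated_integral_defined mN N0 mG' GG' Goo g.
Qed.

Lemma ovm_integral_diff_quotient (c : R[i]) g1 g2 : dominated_by g1 -> dominated_by g2 ->
  ovm_integral lambda G (fun w => c *: (g1 w - g2 w)) =
  c *: (ovm_integral lambda G g1 - ovm_integral lambda G g2).
Proof.
have [N [G' [mN N0 mG' GG' Goo]]] := radon_nikodym_modification.
exact: ovm_integralZB mN N0 mG' GG' Goo c g1 g2.
Qed.

Lemma ovm_integral_cvg (T : pseudoMetricType R) (x : T) (D : set T)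
    (g : T -> borel X -> R[i]^o) g0 :
  (\forall y \near within D (nbhs x), dominated_by (g y)) -> dominated_by g0 ->
  (forall w, g y w @[y --> within D (nbhs x)] --> g0 w) ->
  ovm_integral lambda G (g y) @[y --> within D (nbhs x)] --> ovm_integral lambda G g0.
Proof.
have [N [G' [mN N0 mG' GG' Goo]]] := radon_nikodym_modification.
move=> dg dg0 gg0; apply: cvg_within_seq => z Dz zx.
have zF : z n @[n --> \oo] --> within D (nbhs x).
  move=> A wA; have : \forall n \near \oo, D (z n) -> A (z n) := zx _ wA.
  by move=> [k _ hk]; exists k => // n /hk; apply.
have [k _ hk] := zF _ dg.
rewrite -(cvg_shiftn k).
apply: (ovm_integral_cvg_seq mN N0 mG' GG' Goo) => // [n|w].
  by apply: hk; rewrite /= leq_addl.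
by rewrite (cvg_shiftn k (fun n => g (z n) w)); apply: cvg_comp zF (gg0 w).
Qed.

End ovm_integral.

(** * The mean value inequality and the symmetry of second derivatives *)

Section real_derivative.
Variable R : realType.
Implicit Types E : normedModType R[i].

(** A curve with values in a complex space has a derivative over the reals, which
    forces the real increment h to be cast to a complex scalar. *)
Definition has_deriv E (g : R -> E) (t : R) (l : E) :=
  (h%:C)^-1 *: (g (t + h) - g t) @[h --> 0^'] --> l.

Lemma rnorm_realV E (h : R) (u : E) : rnorm ((h%:C)^-1 *: u) = `|h|^-1 * rnorm u.
Proof. by rewrite -fmorphV rnormZR normfV. Qed.

Lemma has_derivB E (f g : R -> E) t k l : has_deriv f t k -> has_deriv g t l ->
  has_deriv (fun s => f s - g s) t (k - l).
Proof.
move=> fk gl; rewrite /has_deriv.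
have -> : (fun h : R => (h%:C)^-1 *: (f (t + h) - g (t + h) - (f t - g t))) =
    (fun h => (h%:C)^-1 *: (f (t + h) - f t) - (h%:C)^-1 *: (g (t + h) - g t)).
  by apply/funext => h; rewrite -scalerBr !opprB addrACA [in RHS]addrACA;
    congr (_ *: (_ + _)); rewrite addrC.
exact: cvgB.
Qed.

Lemma has_deriv_line E (c : E) t : has_deriv (fun s => s%:C *: c) t c.
Proof.
apply: cvg_near_cst; near=> h; rewrite -scalerBl rmorphD /= addrAC subrr add0r.
rewrite scalerA mulVf ?scale1r // fmorph_eq0; near: h; exact: nbhs_dnbhs_neq.
Unshelve. all: by end_near. Qed.

(** Testing against the conjugate of the increment turns the complex estimate
    into the real mean value theorem without loss in the constant. *)
Lemma mean_value_le (g g' : R -> R[i]^o) (a b M : R) : a <= b ->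
  (forall t, a <= t <= b -> has_deriv g t (g' t)) ->
  (forall t, a <= t <= b -> rnorm (g' t) <= M) ->
  rnorm (g b - g a) <= M * (b - a).
Proof.
move=> ab dg gM.
have M0 : 0 <= M by apply: le_trans (rnorm_ge0 _) (gM a _); rewrite lexx.
set z := g b - g a.
pose c : R[i]^o := z^*; pose f (t : R) : R := complex.Re (c *: g t).
have rc : rnorm c = rnorm z by rewrite !rnorm_complex /c; case: (z) => x y /=; rewrite sqrrN.
have ReB (u v : R[i]^o) : complex.Re (u - v) = complex.Re u - complex.Re v.
  by case: u v => [? ?] [].
have df t : a <= t <= b -> is_derive t 1 f (complex.Re (c *: g' t)).
  move=> tab.
  have h1 : h^-1 *: ((f \o shift t) (h *: 1) - f t) @[h --> 0^'] -->
      complex.Re (c *: g' t).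
    apply/cvgrPdist_lt => e e0.
    have e1 : 0 < e / (rnorm c + 1) by rewrite divr_gt0 // ltr_wpDl ?rnorm_ge0.
    have /cvg_rnormP/(_ _ e1) := dg _ tab.
    apply: filterS => h hlt.
    have -> : h^-1 *: ((f \o shift t) (h *: 1) - f t) =
        complex.Re (c *: ((h%:C)^-1 *: (g (t + h) - g t))).
      rewrite /f /= -ReB -scalerBr [in RHS]scalerA [in RHS]mulrC -[in RHS]scalerA.
      rewrite [h *: 1]mulr1 [h + t]addrC -fmorphV.
      by case: (c *: _) => x y /=; rewrite mul0r subr0.
    rewrite -ReB -scalerBr; apply: le_lt_trans (normr_Re_le _) _.
    rewrite (_ : rnorm _ = rnorm c * rnorm (g' t - (h%:C)^-1 *: (g (t + h) - g t))); last first.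
      exact: rnormZ.
    apply: (@le_lt_trans _ _ ((rnorm c + 1) *
        rnorm (g' t - (h%:C)^-1 *: (g (t + h) - g t)))).
      by rewrite ler_wpM2r ?rnorm_ge0 // lerDl.
    by rewrite mulrC -ltr_pdivlMr // ltr_wpDl ?rnorm_ge0.
  apply: DeriveDef; first by apply/cvg_ex; exists (complex.Re (c *: g' t)).
  exact: cvg_lim h1.
have [t tab ft] : exists2 t, t \in `[a, b]%R &
    f b - f a = complex.Re (c *: g' t) * (b - a).
  apply: MVT_segment => // [t|].
    by rewrite in_itv /= => /andP[/ltW ? /ltW ?]; apply: df; apply/andP.
  apply: derivable_within_continuous => t; rewrite in_itv /= => tab.
  by case: (df t tab).
have fz : f b - f a = rnorm z ^+ 2.
  rewrite /f -ReB -scalerBr -/z rnorm_complex sqr_sqrtr ?addr_ge0 ?sqr_ge0 //.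
  by rewrite /c; case: (z) => x y /=; rewrite mulNr opprK !expr2.
move: tab; rewrite in_itv /= => tab.
have le1 : rnorm z ^+ 2 <= rnorm z * (M * (b - a)).
  rewrite -fz ft mulrA ler_wpM2r ?subr_ge0 // (le_trans (ler_norm _)) //.
  rewrite (le_trans (normr_Re_le _)) //.
  rewrite (_ : rnorm _ = rnorm c * rnorm (g' t)); last exact: rnormZ.
  by rewrite rc ler_wpM2l ?rnorm_ge0 // gM.
have [z0|z0] := eqVneq (rnorm z) 0; first by rewrite z0 mulr_ge0 // subr_ge0.
by rewrite -(@ler_pM2l _ (rnorm z)) -?expr2 // lt_neqAle eq_sym z0 rnorm_ge0.
Qed.

Lemma mean_value (g g' : R -> R[i]^o) (h d M : R) : `|h| < d ->
  (forall t, `|t| < d -> has_deriv g t (g' t)) ->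
  (forall t, `|t| < d -> rnorm (g' t) <= M) ->
  rnorm (g h - g 0) <= M * `|h|.
Proof.
rewrite ltr_norml => /andP[dh hd] dg gM; have [h0|h0] := leP 0 h.
  have le t : 0 <= t <= h -> `|t| < d.
    by move=> /andP[? ?]; rewrite ltr_norml; apply/andP; split; lra.
  rewrite ger0_norm // -[in leRHS](subr0 h).
  by apply: (mean_value_le (g' := g')) => // t /le; [exact: dg|exact: gM].
have le t : h <= t <= 0 -> `|t| < d.
  by move=> /andP[? ?]; rewrite ltr_norml; apply/andP; split; lra.
rewrite ltr0_norm // rnormB -[in leRHS](sub0r h).
by apply: (mean_value_le (g' := g')) => // [|t /le|t /le]; [exact: ltW|exact: dg|exact: gM].
Qed.

(** Let A = phi12 0 0. The mean value inequality, applied in s and then in t to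
    phi s t - s t A, bounds the deviation of the second difference of phi from
    h k A by e |h| |k| for small h and k. Dividing by k, which then tends to 0, one
    obtains that phi2 h - phi2 0 differs from h A by at most e |h|. *)
Lemma schwarz (phi phi1 phi12 : R -> R -> R[i]^o) (phi2 : R -> R[i]^o) (d : R) :
  0 < d ->
  (forall s t, `|s| < d -> `|t| < d -> has_deriv (phi^~ t) s (phi1 s t)) ->
  (forall s, `|s| < d -> has_deriv (phi s) 0 (phi2 s)) ->
  (forall s t, `|s| < d -> `|t| < d -> has_deriv (phi1 s) t (phi12 s t)) ->
  (forall e, 0 < e -> exists2 r, 0 < r & forall s t, `|s| < r -> `|t| < r ->
     rnorm (phi12 s t - phi12 0 0) <= e) ->
  has_deriv phi2 0 (phi12 0 0).
Proof.
move=> d0 d1 d2 d12 c12; set A := phi12 0 0.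
have second_diff e : 0 < e -> exists2 r, 0 < r <= d & forall h k, `|h| < r -> `|k| < r ->
    rnorm (phi h k - phi h 0 - (phi 0 k - phi 0 0) - h%:C *: (k%:C *: A)) <= e * `|k| * `|h|.
  move=> e0; have [r r0 hr] := c12 _ e0.
  exists (Num.min r d); first by rewrite lt_min r0 d0 /= ge_min lexx orbT.
  move=> h k hlt klt.
  have lr s : `|s| < Num.min r d -> `|s| < r by rewrite lt_min => /andP[].
  have ld s : `|s| < Num.min r d -> `|s| < d by rewrite lt_min => /andP[].
  pose g s : R[i]^o := (phi s k - phi s 0) - s%:C *: (k%:C *: A).
  pose g' s : R[i]^o := (phi1 s k - phi1 s 0) - k%:C *: A.
  have -> : phi h k - phi h 0 - (phi 0 k - phi 0 0) - h%:C *: (k%:C *: A) = g h - g 0.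
    by rewrite /g scale0r subr0 addrAC.
  apply: (@mean_value g g' h (Num.min r d)) => // s slt.
    apply: has_derivB; last exact: has_deriv_line.
    have m0 : `|0 : R| < d by rewrite normr0.
    by apply: has_derivB; apply: d1 => //; exact: ld.
  pose u t : R[i]^o := phi1 s t - t%:C *: A.
  have -> : g' s = u k - u 0 by rewrite /g' /u scale0r subr0 addrAC.
  apply: (@mean_value u (fun t => phi12 s t - A) k (Num.min r d)) => // t tlt.
    apply: has_derivB; last exact: has_deriv_line.
    by apply: d12; exact: ld.
  by apply: hr; exact: lr.
apply/cvg_rnormP => e e0; have e2 : 0 < e / 2 by rewrite divr_gt0.
have [r /andP[r0 rd] hr] := second_diff _ e2.
near=> h.
have h0 : h != 0 by near: h; exact: nbhs_dnbhs_neq.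
have hlt : `|h| < r by near: h; exact: dnbhs0_lt.
have nh : 0 < `|h| by rewrite normr_gt0.
suff key : rnorm ((phi2 h - phi2 0) - h%:C *: A) <= e / 2 * `|h|.
  apply: (@le_lt_trans _ _ (e / 2)); last by rewrite ltr_pdivrMr // ltr_pMr // ltr1n.
  rewrite add0r rnormB.
  have -> : (h%:C)^-1 *: (phi2 h - phi2 0) - A =
      (h%:C)^-1 *: ((phi2 h - phi2 0) - h%:C *: A).
    by rewrite [RHS]scalerBr scalerA mulVf ?scale1r // fmorph_eq0.
  by rewrite rnorm_realV mulrC ler_pdivrMr.
have cvgk : ((k%:C)^-1 *: (phi h (0 + k) - phi h 0)
    - (k%:C)^-1 *: (phi 0 (0 + k) - phi 0 0)) @[k --> 0^'] --> phi2 h - phi2 0.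
  apply: cvgB; first exact: d2 (lt_le_trans hlt rd).
  by apply: d2; rewrite normr0.
apply: (cvg_rnorm_le cvgk); near=> k.
have k0 : k != 0 by near: k; exact: nbhs_dnbhs_neq.
have klt : `|k| < r by near: k; exact: dnbhs0_lt.
have nk : 0 < `|k| by rewrite normr_gt0.
rewrite add0r -scalerBr.
have -> : (k%:C)^-1 *: (phi h k - phi h 0 - (phi 0 k - phi 0 0)) - h%:C *: A =
    (k%:C)^-1 *: (phi h k - phi h 0 - (phi 0 k - phi 0 0) - h%:C *: (k%:C *: A)).
  rewrite [RHS]scalerBr; congr (_ - _); rewrite !scalerA mulrCA mulVf ?mulr1 //.
  by rewrite fmorph_eq0.
rewrite rnorm_realV mulrC ler_pdivrMr // mulrAC; exact: hr.
Unshelve. all: by end_near. Qed.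

End real_derivative.

Section directional_derivative.
Variables (R : realType) (W : normedModType R).
Implicit Types E : normedModType R[i].

(** The two variables of a kernel are treated as one variable in a product space,
    so that a single statement covers the partial derivatives in either variable. *)
Definition has_dir E (F : W -> E) (v z : W) (l : E) :=
  (h%:C)^-1 *: (F (z + h *: v) - F z) @[h --> 0^'] --> l.

Lemma has_dir_line E (F : W -> E) v z t l :
  has_dir F v (z + t *: v) l -> has_deriv (fun s => F (z + s *: v)) t l.
Proof.
rewrite /has_dir /has_deriv.
suff -> : (fun h : R => (h%:C)^-1 *: (F (z + (t + h) *: v) - F (z + t *: v))) =
  (fun h => (h%:C)^-1 *: (F (z + t *: v + h *: v) - F (z + t *: v))) by [].
by apply/funext => h; rewrite scalerDl addrA.
Qed.

Lemma open_plane (O : set W) z u v : open O -> O z ->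
  exists2 d, 0 < d & forall s t : R, `|s| < d -> `|t| < d -> O (z + s *: u + t *: v).
Proof.
move=> oO Oz; have : nbhs z O by apply: open_nbhs_nbhs; split.
move=> /nbhs_ballP[r /= r0 zO]; pose k := `|u| + `|v| + 1.
have k0 : 0 < k by rewrite ltr_wpDl // addr_ge0.
exists (r / k) => [|s t slt tlt]; first exact: divr_gt0.
apply: zO; rewrite -ball_normE /= !opprD !addrA subrr add0r -opprD normrN.
rewrite (le_lt_trans (ler_normD _ _)) // !normrZ.
have d0 : 0 < r / k by exact: divr_gt0.
rewrite (@le_lt_trans _ _ (r / k * (`|u| + `|v|))) //.
  by rewrite mulrDr lerD // ler_wpM2r // ltW.
by rewrite mulrAC ltr_pdivrMr // ltr_pM2l // ltrDl.
Qed.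

Lemma open_line (O : set W) z v : open O -> O z ->
  exists2 d, 0 < d & forall t : R, `|t| < d -> O (z + t *: v).
Proof.
move=> oO Oz; have [d d0 Od] := open_plane v 0 oO Oz; exists d => // t td.
by have := Od t 0 td; rewrite scale0r addr0 normr0; apply.
Qed.

(** This is [schwarz] in the plane through z spanned by u and v. It makes the
    derivative along u of F2 available from the mixed derivative in the other
    order. *)
Lemma schwarz_dir (O : set W) (F F1 F2 F12 : W -> R[i]^o) u v :
  open O ->
  (forall z, O z -> has_dir F u z (F1 z)) ->
  (forall z, O z -> has_dir F v z (F2 z)) ->
  (forall z, O z -> has_dir F1 v z (F12 z)) ->
  (forall z, O z -> {for z, continuous F12}) ->
  forall z, O z -> has_dir F2 u z (F12 z).
Proof.
move=> oO d1 d2 d12 c12 z Oz.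
have [d d0 Od] := open_plane u v oO Oz.
have Od0 s : `|s| < d -> O (z + s *: u).
  by move=> sd; have := Od s 0 sd; rewrite scale0r addr0 normr0; apply.
pose pl (G : W -> R[i]^o) s t := G (z + s *: u + t *: v).
have := @schwarz R (pl F) (pl F1) (pl F12) (fun s => F2 (z + s *: u)) d d0.
have -> : pl F12 0 0 = F12 z by rewrite /pl !scale0r !addr0.
move=> sw; have : has_deriv (fun s => F2 (z + s *: u)) 0 (F12 z).
  apply: sw => [s t slt tlt|s slt|s t slt tlt|e e0].
  - have -> : (pl F)^~ t = (fun r => F (z + t *: v + r *: u)).
      by apply/funext => r; rewrite /pl addrAC.
    by apply: has_dir_line; rewrite addrAC; apply: d1; exact: Od.
  - by apply: has_dir_line; rewrite scale0r addr0; apply: d2; exact: Od0.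
  - by apply: has_dir_line; apply: d12; exact: Od.
  - have /cvg_rnormP/(_ _ e0) := c12 z Oz.
    move=> near12.
    have [r r0 Or] : exists2 r, 0 < r & forall s t : R, `|s| < r -> `|t| < r ->
        rnorm (F12 z - F12 (z + s *: u + t *: v)) < e.
      have [A [oA Az] Asub] : exists2 A, open_nbhs z A &
          A `<=` [set y | rnorm (F12 z - F12 y) < e].
        by move: near12; rewrite /= nbhsE.
      have [r r0 hr] := open_plane u v oA Az.
      by exists r => // s t slt tlt; apply: Asub; exact: hr.
    by exists r => // s t slt tlt; rewrite rnormB ltW // Or.
rewrite /has_dir /has_deriv.
suff -> : (fun h : R => (h%:C)^-1 *: (F2 (z + (0 + h) *: u) - F2 (z + 0 *: u))) =
  (fun h => (h%:C)^-1 *: (F2 (z + h *: u) - F2 z)) by [].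
by apply/funext => h; rewrite add0r scale0r addr0.
Qed.

End directional_derivative.

(** * Iterated derivatives in an arbitrary order *)

(** A word stands for an iterated derivative D, the last letter being applied first.
    Only derivatives along sorted words are known to exist and to be continuous; a
    further letter c has to be moved to its place in the word, past every letter b of
    smaller rank. The predicate good bounds the orders of the derivatives. *)
Section sorted_words.
Variables (R : realType) (W : normedModType R) (O : set W).
Hypothesis oO : open O.
Variables (I : eqType) (rk : I -> nat) (dir : I -> W).
Variables (D : seq I -> W -> R[i]^o) (good : seq I -> bool).
Local Notation le := (fun c d => (rk c <= rk d)%N).
Hypothesis good_perm : forall l l', perm_eq l l' -> good l = good l'.
Hypothesis good_behead : forall c l, good (c :: l) -> good l.
Hypothesis D_der : forall c l, sorted le (c :: l) -> good (c :: l) ->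
  forall z, O z -> has_dir (D l) (dir c) z (D (c :: l) z).
Hypothesis D_cont : forall l, sorted le l -> good l ->
  forall z, O z -> {for z, continuous (D l)}.

Fixpoint insert (c : I) (l : seq I) :=
  if l is b :: l' then
    if (rk c <= rk b)%N then c :: l else b :: insert c l'
  else [:: c].

Lemma perm_insert c l : perm_eq (insert c l) (c :: l).
Proof.
elim: l => //= b l ih; case: ifP => // _.
apply: (@perm_trans _ [:: b, c & l]); first by rewrite perm_cons.
exact: permEl (perm_catCA [:: b] [:: c] l).
Qed.

Lemma sorted_insert c l : sorted le l -> sorted le (insert c l).
Proof.
have tr : transitive le by move=> ? ? ?; exact: leq_trans.
rewrite !sorted_pairwise //; elim: l => //= b l ih /andP[bl sl].
case: ifPn => [cb|]; rewrite /= ?cb ?bl ?sl ?ih //=.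
  by rewrite !andbT; apply: sub_all bl => d; exact: leq_trans.
rewrite -ltnNge => bc; rewrite andbT (perm_all _ (perm_insert c l)) /= (ltnW bc).
exact: bl.
Qed.

(** When c passes b, the derivatives of D l along c (by induction) and along b are
    known, and so is the one along b of the derivative along c, because both words
    involved are sorted. Schwarz's theorem then gives the one along c of the
    derivative along b. *)
Lemma has_dir_insert c l : sorted le l -> good (c :: l) ->
  forall z, O z -> has_dir (D l) (dir c) z (D (insert c l) z).
Proof.
elim: l => [|b l ih] sl gl z Oz; first exact: D_der.
rewrite /=; case: ifPn => [cb|]; first by apply: D_der => //=; rewrite cb.
rewrite -ltnNge => bc.
have sl' : sorted le l by exact: path_sorted sl.
have pl : perm_eq [:: c, b & l] (b :: insert c l).
  apply: (@perm_trans _ [:: b, c & l]); first exact: permEl (perm_catCA [:: c] [:: b] l).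
  by rewrite perm_cons perm_sym perm_insert.
have gbi : good (b :: insert c l) by rewrite -(good_perm pl).
have sbi : sorted le (b :: insert c l).
  by have := sorted_insert c sl; rewrite /= leqNgt bc.
have gcl : good (c :: l).
  by rewrite -(good_perm (perm_insert c l)); exact: good_behead gbi.
apply: (schwarz_dir oO (ih sl' gcl) _ _ _ Oz).
- by apply: D_der => //; exact: good_behead gl.
- exact: D_der.
- exact: D_cont.
Qed.

End sorted_words.

Section multi_indices.
Variable m : nat.
Implicit Types (a b : 'I_m -> nat) (s t : seq 'I_m).

Definition add_multi a b : 'I_m -> nat := fun i => (a i + b i)%N.
Definition unit_multi (j : 'I_m) : 'I_m -> nat := fun i => (j == i).

Lemma multi_order_add a b : multi_order (add_multi a b) = (multi_order a + multi_order b)%N.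
Proof. exact: big_split. Qed.

Lemma multi_order_unit j : multi_order (unit_multi j) = 1%N.
Proof.
rewrite /multi_order (bigD1 j) //= /unit_multi eqxx big1 // => i ij.
by rewrite eq_sym (negbTE ij).
Qed.

Lemma count_mem_directions a i : count_mem i (directions a) = a i.
Proof.
rewrite /directions count_flatten -map_comp sumnE big_map big_enum /=.
rewrite (bigD1 i) //= count_nseq /= eqxx mul1n big1 ?addn0 // => j ji.
by rewrite count_nseq /= (negbTE ji).
Qed.

Lemma directions_sorted a : sorted (fun i j : 'I_m => (i <= j)%N) (directions a).
Proof.
set le := (X in sorted X).
have tr : transitive le by move=> ? ? ?; exact: leq_trans.
rewrite sorted_pairwise // /directions.
have : pairwise le (enum 'I_m).
  by rewrite -sorted_pairwise //; have := iota_sorted 0 m; rewrite -val_enum_ord sorted_map.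
elim: (enum 'I_m) => //= j s ih /andP[js sl]; rewrite pairwise_cat ih // andbT.
apply/andP; split; last by elim: (a j) => //= n ->; rewrite all_nseq /le leqnn orbT.
apply/allrelP => x y; rewrite mem_nseq => /andP[_ /eqP ->].
by move=> /flattenP[_ /mapP[k ks ->]]; rewrite mem_nseq => /andP[_ /eqP ->]; exact: (allP js).
Qed.

(** The letters inl i and inr i are the partial derivatives in the first and in the
    second variable. The latter have the higher rank, so that they stand last in a
    sorted word and are taken first, as in a mixed partial derivative. *)
Definition word a b : seq ('I_m + 'I_m) :=
  map inl (directions a) ++ map inr (directions b).

Definition rank (c : 'I_m + 'I_m) : nat :=
  match c with inl i => i | inr i => (m + i)%N end.

Local Notation le := (fun c d => (rank c <= rank d)%N).

Lemma rank_inj : injective rank.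
Proof.
move=> [i|i] [j|j] /= e.
- by congr inl; apply: val_inj.
- by have := ltn_ord i; rewrite e ltnNge leq_addr.
- by have := ltn_ord j; rewrite -e ltnNge leq_addr.
- by congr inr; apply: val_inj; apply: (@addnI m).
Qed.

Lemma word_sorted a b : sorted le (word a b).
Proof.
have tr : transitive le by move=> ? ? ?; exact: leq_trans.
have trI : transitive (fun i j : 'I_m => (i <= j)%N) by move=> ? ? ?; exact: leq_trans.
rewrite sorted_pairwise // /word pairwise_cat !pairwise_map; apply/and3P; split.
- apply/allrelP => _ _ /mapP[i _ ->] /mapP[j _ ->] /=.
  by apply: ltnW; apply: leq_trans (ltn_ord i) (leq_addr _ _).
- by have := directions_sorted a; rewrite sorted_pairwise.
- have := directions_sorted b; rewrite sorted_pairwise //.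
  by apply: sub_pairwise => i j /=; rewrite leq_add2l.
Qed.

Definition mult1 (l : seq ('I_m + 'I_m)) : 'I_m -> nat := fun i => count_mem (inl i) l.
Definition mult2 (l : seq ('I_m + 'I_m)) : 'I_m -> nat := fun i => count_mem (inr i) l.

Lemma mult1_word a b : mult1 (word a b) = a.
Proof.
apply/funext => i; rewrite /mult1 /word count_cat !count_map.
rewrite -[RHS](count_mem_directions a i) [X in (_ + X)%N](_ : _ = 0%N) ?addn0.
  by apply: eq_count => j.
by rewrite (@eq_count _ _ pred0) ?count_pred0 // => j.
Qed.

Lemma mult2_word a b : mult2 (word a b) = b.
Proof.
apply/funext => i; rewrite /mult2 /word count_cat !count_map.
rewrite -[RHS](count_mem_directions b i) [X in (X + _)%N](_ : _ = 0%N) ?add0n.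
  by apply: eq_count => j.
by rewrite (@eq_count _ _ pred0) ?count_pred0 // => j.
Qed.

(** Sorted words with equal multiplicities are equal, so that the sorted words are
    exactly the words of pairs of multi-indices. *)
Lemma sorted_word l : sorted le l -> l = word (mult1 l) (mult2 l).
Proof.
move=> sl; apply: (sorted_eq _ _ sl (word_sorted _ _)).
- by move=> ? ? ?; exact: leq_trans.
- by move=> c d; rewrite -eqn_leq => /eqP /rank_inj.
apply/allP => c _ /=; apply/eqP; case: c => i.
- by rewrite -[RHS]/(mult1 (word _ _) i) mult1_word.
- by rewrite -[RHS]/(mult2 (word _ _) i) mult2_word.
Qed.

Lemma insert_word1 i a b : insert rank (inl i) (word a b) = word (add_multi a (unit_multi i)) b.
Proof.
rewrite [LHS]sorted_word ?sorted_insert ?word_sorted //.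
have p := perm_insert rank (inl i) (word a b).
congr word; apply/funext => j.
- rewrite /mult1 (permP p) /= -/(mult1 _ _) mult1_word addnC; congr (_ + _)%N.
- by rewrite /mult2 (permP p) /= -/(mult2 _ _) mult2_word.
Qed.

Lemma insert_word2 i a b : insert rank (inr i) (word a b) = word a (add_multi b (unit_multi i)).
Proof.
rewrite [LHS]sorted_word ?sorted_insert ?word_sorted //.
have p := perm_insert rank (inr i) (word a b).
congr word; apply/funext => j.
- by rewrite /mult1 (permP p) /= -/(mult1 _ _) mult1_word.
- rewrite /mult2 (permP p) /= -/(mult2 _ _) mult2_word addnC; congr (_ + _)%N.
Qed.

End multi_indices.

(** * Differentiation under the integral *)

Section differentiation_under_the_integral.
Variables (R : realType) (H : completeNormedModType R[i]) (X : ptopologicalType).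
Variable lambda : {finite_measure set (borel X) -> \bar R}.
Variables (L : set (borel X) -> 'L(H)) (G : borel X -> 'L(H)).
Hypothesis LG : radon_nikodym_decomposition lambda G L.
Variable h : borel X -> R[i]^o.
Hypothesis h_int : complex_integrable (variation L) h.
Variables (W : normedModType R) (O : set W).
Hypothesis oO : open O.

(** By the mean value inequality the difference quotients of K inherit the bound h
    of its derivative K', so that dominated convergence applies to them. *)
Lemma ovm_integral_has_dir (v : W) (K K' : borel X -> W -> R[i]^o) :
  (forall z, O z -> dominated_by h (K^~ z)) ->
  (forall z, O z -> dominated_by h (K'^~ z)) ->
  (forall w z, O z -> has_dir (K w) v z (K' w z)) ->
  forall z, O z -> has_dir (fun z => ovm_integral lambda G (K^~ z)) v z
    (ovm_integral lambda G (K'^~ z)).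
Proof.
move=> dK dK' KK' z Oz; have [d d0 Od] := open_line v oO Oz.
pose g (t : R) : borel X -> R[i]^o := fun w => (t%:C)^-1 *: (K w (z + t *: v) - K w z).
have near_d : \forall t \near (0 : R)^', t != 0 /\ `|t| < d.
  by near=> t; split; near: t; [exact: nbhs_dnbhs_neq|exact: dnbhs0_lt].
have dg : \forall t \near (0 : R)^', dominated_by h (g t).
  apply: filterS near_d => t [t0 td]; split.
    apply: bochner_measurableZ; apply: bochner_measurableB.
      by case: (dK _ (Od _ td)).
    by case: (dK _ Oz).
  move=> w; rewrite /g rnorm_realV mulrC ler_pdivrMr ?normr_gt0 //.
  have := @mean_value R (fun s => K w (z + s *: v)) (fun s => K' w (z + s *: v))
    t d (rnorm (h w)) td.
  rewrite scale0r addr0; apply=> s sd.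
    by apply: has_dir_line; apply: KK'; exact: Od.
  by case: (dK' _ (Od _ sd)).
have cvg_g := @ovm_integral_cvg _ _ _ _ _ _ LG _ h_int R 0 (fun t => t != 0) g
  (K'^~ z) dg (dK' _ Oz) (fun w => KK' w z Oz).
apply: cvg_trans cvg_g; apply: near_eq_cvg.
apply: filterS near_d => t [t0 td].
by rewrite (ovm_integral_diff_quotient LG h_int) //; [exact/dK/Od|exact: dK].
Unshelve. all: by end_near. Qed.

Lemma ovm_integral_continuous (K : borel X -> W -> R[i]^o) :
  (forall z, O z -> dominated_by h (K^~ z)) ->
  (forall w z, O z -> {for z, continuous (K w)}) ->
  forall z, O z -> {for z, continuous (fun z => ovm_integral lambda G (K^~ z))}.
Proof.
move=> dK cK z Oz.
have := @ovm_integral_cvg _ _ _ _ _ _ LG _ h_int W z setT (fun y => K^~ y) (K^~ z).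
have -> : within setT (nbhs z) = nbhs z.
  apply/funext => A; rewrite /within; congr (nbhs z _); apply/funext => y.
  by apply/propext; split=> [/(_ Logic.I)|].
apply => [||w]; [|exact: dK|exact: cK].
have : nbhs z O by apply: open_nbhs_nbhs; split.
by apply: filterS => y; exact: dK.
Qed.

End differentiation_under_the_integral.

(** * Partial derivatives of kernels *)

Section partials.
Variables (R : realType) (m : nat) (E : normedModType R[i]).
Local Notation V := 'rV[R]_m.
Local Notation I := ('I_m + 'I_m)%type.
Implicit Types (g : V -> E) (f : V -> V -> E) (a b c d : 'I_m -> nat).

Definition has_partial_to g i x (l : E) := diff_quotient g i x h @[h --> 0^'] --> l.

Lemma has_partial_toP g i x l : has_partial_to g i x l ->
  has_partial g i x /\ partial g i x = l.
Proof.
move=> gl; split; first by apply/cvg_ex; exists l.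
exact: (cvg_lim (@norm_hausdorff _ E) gl).
Qed.

Definition joint f (z : V * V) : E := f z.1 z.2.

Definition joint_dir (c : I) : V * V :=
  match c with inl i => (delta_mx 0 i, 0) | inr i => (0, delta_mx 0 i) end.

Definition partial_letter (c : I) f :=
  match c with inl i => partial1 i f | inr i => partial2 i f end.

Lemma has_dir_joint1 f i x y l :
  has_dir (joint f) (joint_dir (inl i)) (x, y) l <-> has_partial_to (f^~ y) i x l.
Proof.
rewrite /has_dir /has_partial_to.
suff -> : (fun h : R => (h%:C)^-1 *:
    (joint f ((x, y) + h *: joint_dir (inl i)) - joint f (x, y))) =
  diff_quotient (f^~ y) i x by [].
by apply/funext => h; rewrite /joint /= scaler0 addr0.
Qed.

Lemma has_dir_joint2 f i x y l :
  has_dir (joint f) (joint_dir (inr i)) (x, y) l <-> has_partial_to (f x) i y l.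
Proof.
rewrite /has_dir /has_partial_to.
suff -> : (fun h : R => (h%:C)^-1 *:
    (joint f ((x, y) + h *: joint_dir (inr i)) - joint f (x, y))) =
  diff_quotient (f x) i y by [].
by apply/funext => h; rewrite /joint /= scaler0 addr0.
Qed.

Lemma foldr_letter1 f s :
  foldr partial_letter f (map inl s) = foldr (@partial1 R m E) f s.
Proof. by elim: s => //= i s ->. Qed.

Lemma foldr_letter2 f s :
  foldr partial_letter f (map inr s) = foldr (@partial2 R m E) f s.
Proof. by elim: s => //= i s ->. Qed.

Lemma mixed_partial_word a b f :
  foldr partial_letter f (word a b) = mixed_partial a b f.
Proof. by rewrite /word foldr_cat foldr_letter2 foldr_letter1. Qed.

Lemma has_partialW g i x : has_partial g i x -> has_partial_to g i x (partial g i x).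
Proof. by []. Qed.

Variable U : set V.
Hypothesis oU : open U.

Lemma open_joint : open (U `*` U).
Proof.
have -> : U `*` U = (fst @^-1` U) `&` (snd @^-1` U :> set (V * V)) by [].
by apply: openI; apply: open_comp => // z _; [exact: cvg_fst|exact: cvg_snd].
Qed.

(** Derivatives at a point of the open set U depend only on the values in U. This is
    needed because mixed partial derivatives are total functions, about which
    nothing is known outside U. *)
Lemma has_partial_to_eq g g' i x l : (forall y, U y -> g y = g' y) -> U x ->
  has_partial_to g i x l -> has_partial_to g' i x l.
Proof.
move=> gg' Ux; apply: cvg_trans; apply: near_eq_cvg.
have [d d0 Ud] := open_line (delta_mx 0 i) oU Ux.
near=> t; have td : `|t| < d by near: t; exact: dnbhs0_lt.
by rewrite /diff_quotient !gg' //; exact: Ud.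
Unshelve. all: by end_near. Qed.

(** Inside such a family an iterated derivative stays in the family: each step adds
    one to a multi-index, so that the order of the steps does not matter. *)
Section closed_families.
Variables (q : nat) (Q : ('I_m -> nat) -> ('I_m -> nat) -> V -> V -> E).
Hypothesis Q1 : forall a b i, (multi_order a < q)%N -> (multi_order b <= q)%N ->
  forall x y, U x -> U y -> has_partial_to ((Q a b)^~ y) i x (Q (add_multi a (unit_multi i)) b x y).
Hypothesis Q2 : forall a b i, (multi_order a <= q)%N -> (multi_order b < q)%N ->
  forall x y, U x -> U y -> has_partial_to (Q a b x) i y (Q a (add_multi b (unit_multi i)) x y).

Definition multiplicity (s : seq 'I_m) : 'I_m -> nat := fun i => count_mem i s.

Lemma multiplicity_directions a : multiplicity (directions a) = a.
Proof. by apply/funext => i; exact: count_mem_directions. Qed.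

Lemma multiplicity_cons a i s : add_multi (add_multi a (multiplicity s)) (unit_multi i) =
  add_multi a (multiplicity (i :: s)).
Proof.
apply/funext => j; rewrite /add_multi /multiplicity /= -addnA.
by rewrite [in LHS](addnC (count_mem j s)).
Qed.

Lemma multi_order_multiplicity_cons i s :
  multi_order (multiplicity (i :: s)) = (multi_order (multiplicity s)).+1.
Proof.
rewrite -addn1 -(multi_order_unit i) -multi_order_add.
by congr multi_order; apply/funext => j; rewrite /add_multi addnC.
Qed.

Lemma closed_family_partials2 a b t :
  (multi_order a <= q)%N -> (multi_order b + multi_order (multiplicity t) <= q)%N ->
  has_partials2 U t (Q a b) /\
  forall x y, U x -> U y ->
    foldr (@partial2 R m E) (Q a b) t x y = Q a (add_multi b (multiplicity t)) x y.
Proof.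
move=> aq; elim: t => [|i t ih] /=.
  by move=> _; split=> // x y _ _; congr Q; apply/funext => i; rewrite /add_multi addn0.
rewrite multi_order_multiplicity_cons addnS => lt.
have [ih1 ih2] := ih (ltnW lt).
have key x y : U x -> U y -> has_partial_to (foldr (@partial2 R m E) (Q a b) t x) i y
    (Q a (add_multi b (multiplicity (i :: t))) x y).
  move=> Ux Uy; rewrite -multiplicity_cons.
  apply: (@has_partial_to_eq (Q a (add_multi b (multiplicity t)) x)) => //.
    by move=> y' Uy'; rewrite ih2.
  by apply: Q2 => //; rewrite multi_order_add.
split; last by move=> x y Ux Uy; exact: (has_partial_toP (key x y Ux Uy)).2.
by split=> // x y Ux Uy; exact: (has_partial_toP (key x y Ux Uy)).1.
Qed.

Lemma closed_family_partials1 a b s f :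
  (forall x y, U x -> U y -> f x y = Q a b x y) ->
  (multi_order b <= q)%N -> (multi_order a + multi_order (multiplicity s) <= q)%N ->
  has_partials1 U s f /\
  forall x y, U x -> U y ->
    foldr (@partial1 R m E) f s x y = Q (add_multi a (multiplicity s)) b x y.
Proof.
move=> fQ bq; elim: s => [|i s ih] /=.
  move=> _; split=> // x y Ux Uy; rewrite fQ //; congr Q.
  by apply/funext => i; rewrite /add_multi addn0.
rewrite multi_order_multiplicity_cons addnS => lt.
have [ih1 ih2] := ih (ltnW lt).
have key x y : U x -> U y -> has_partial_to ((foldr (@partial1 R m E) f s)^~ y) i x
    (Q (add_multi a (multiplicity (i :: s))) b x y).
  move=> Ux Uy; rewrite -multiplicity_cons.
  apply: (@has_partial_to_eq ((Q (add_multi a (multiplicity s)) b)^~ y)) => //.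
    by move=> x' Ux'; rewrite ih2.
  by apply: Q1 => //; rewrite multi_order_add.
split; last by move=> x y Ux Uy; exact: (has_partial_toP (key x y Ux Uy)).2.
by split=> // x y Ux Uy; exact: (has_partial_toP (key x y Ux Uy)).1.
Qed.

Lemma closed_family_mixed_partial a b c d :
  (multi_order a + multi_order c <= q)%N -> (multi_order b + multi_order d <= q)%N ->
  has_mixed_partial U c d (Q a b) /\
  forall x y, U x -> U y ->
    mixed_partial c d (Q a b) x y = Q (add_multi a c) (add_multi b d) x y.
Proof.
move=> acq bdq.
have aq : (multi_order a <= q)%N by apply: leq_trans acq; exact: leq_addr.
have := @closed_family_partials2 a b (directions d) aq.
rewrite multiplicity_directions => /(_ bdq)[h1 h2].
have := @closed_family_partials1 a (add_multi b d) (directions c) _ h2.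
by rewrite multiplicity_directions multi_order_add => /(_ bdq acq)[h3 h4].
Qed.

End closed_families.
End partials.

(** The derivatives of a kernel whose mixed partial derivatives up to order q exist
    and are continuous form a family as in [closed_family_mixed_partial]: this is
    [has_dir_insert] for words in the partial derivatives. *)
Section regular_kernels.
Variables (R : realType) (m : nat) (U : set 'rV[R]_m) (q : nat).
Local Notation V := 'rV[R]_m.
Local Notation I := ('I_m + 'I_m)%type.
Hypothesis oU : open U.
Variable f : V -> V -> R[i]^o.
Hypothesis f_der : forall a b, (multi_order a <= q)%N -> (multi_order b <= q)%N ->
  has_mixed_partial U a b f.
Hypothesis f_cont : forall a b, (multi_order a <= q)%N -> (multi_order b <= q)%N ->
  forall z, (U `*` U) z -> {for z, continuous (joint (mixed_partial a b f))}.

Let D (l : seq I) : V * V -> R[i]^o := joint (foldr (@partial_letter R m R[i]^o) f l).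
Let good (l : seq I) : bool :=
  ((multi_order (mult1 l) <= q) && (multi_order (mult2 l) <= q))%N.
Local Notation le := (fun c d : I => (rank c <= rank d)%N).

Let D_word a b : D (word a b) = joint (mixed_partial a b f).
Proof. by rewrite /D mixed_partial_word. Qed.

Let good_word a b : good (word a b) = ((multi_order a <= q) && (multi_order b <= q))%N.
Proof. by rewrite /good mult1_word mult2_word. Qed.

Let good_perm l l' : perm_eq l l' -> good l = good l'.
Proof.
move=> /permP p; rewrite /good.
by congr (_ && _); congr (_ <= _)%N; apply: eq_bigr => i _; exact: p.
Qed.

Let good_behead c l : good (c :: l) -> good l.
Proof.
by move=> /andP[h1 h2]; apply/andP; split; [apply: leq_trans h1|apply: leq_trans h2];
  apply: leq_sum => i _; exact: leq_addl.
Qed.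

Let D_der c l : sorted le (c :: l) -> good (c :: l) ->
  forall z, (U `*` U) z -> has_dir (D l) (joint_dir R c) z (D (c :: l) z).
Proof.
move=> /sorted_word; move: (mult1 _) (mult2 _) => a b cl; rewrite cl good_word.
move=> /andP[aq bq] [x y] [/= Ux Uy]; have [h2 h1] := f_der aq bq.
rewrite /D -cl; move: cl; rewrite /word; case: (directions a) h1 => [|i s] /=.
  case: (directions b) h2 => //= i t [_ h2] _ [-> ->].
  apply/has_dir_joint2; rewrite /joint /= /partial2 foldr_letter2.
  exact: has_partialW (h2 _ _ Ux Uy).
move=> [_ h1] [-> ->]; apply/has_dir_joint1.
rewrite /joint /= /partial1 foldr_cat foldr_letter2 foldr_letter1.
exact: has_partialW (h1 _ _ Ux Uy).
Qed.

Let D_cont l : sorted le l -> good l ->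
  forall z, (U `*` U) z -> {for z, continuous (D l)}.
Proof.
move=> /sorted_word ->; rewrite good_word D_word => /andP[aq bq].
exact: f_cont.
Qed.

Lemma has_dir_mixed_partial1 a b i : (multi_order a < q)%N -> (multi_order b <= q)%N ->
  forall z, (U `*` U) z -> has_dir (joint (mixed_partial a b f)) (joint_dir R (inl i)) z
    (joint (mixed_partial (add_multi a (unit_multi i)) b f) z).
Proof.
move=> aq bq z Oz; rewrite -!D_word -insert_word1.
apply: (has_dir_insert (open_joint oU) good_perm good_behead D_der D_cont) => //.
  exact: word_sorted.
rewrite -(good_perm (perm_insert (@rank m) _ _)) insert_word1 good_word.
by rewrite multi_order_add multi_order_unit addn1 aq.
Qed.

Lemma has_dir_mixed_partial2 a b i : (multi_order a <= q)%N -> (multi_order b < q)%N ->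
  forall z, (U `*` U) z -> has_dir (joint (mixed_partial a b f)) (joint_dir R (inr i)) z
    (joint (mixed_partial a (add_multi b (unit_multi i)) f) z).
Proof.
move=> aq bq z Oz; rewrite -!D_word -insert_word2.
apply: (has_dir_insert (open_joint oU) good_perm good_behead D_der D_cont) => //.
  exact: word_sorted.
rewrite -(good_perm (perm_insert (@rank m) _ _)) insert_word2 good_word.
by rewrite multi_order_add multi_order_unit addn1 aq.
Qed.

End regular_kernels.

(** * Kernels integrated against the operator valued measure *)

Lemma continuous_borel_measurable (R : realType) (X : ptopologicalType) (f : X -> R) :
  continuous f -> measurable_fun (setT : set (borel X)) f.
Proof.
move=> cf; apply: (measurability _ (RGenOpens.measurableE R)).
move=> _ [_ [a [b ->]] <-]; rewrite setTI; apply: sub_sigma_algebra.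
by move/continuousP: cf; apply; exact: itv_open.
Qed.

Lemma continuous_bochner_measurable (R : realType) (X : ptopologicalType)
    (g : X -> R[i]^o) :
  continuous g -> bochner_measurable (g : borel X -> R[i]^o).
Proof.
move=> cg.
have part (f : R[i]^o -> R) : (forall z, `|f z| <= rnorm z) ->
    (forall z z', f (z - z') = f z - f z') -> continuous (fun w => f (g w)).
  move=> fle fB w; apply/cvgrPdist_lt => e e0.
  have /cvg_rnormP/(_ _ e0) := cg w.
  by apply: filterS => w'; apply: le_lt_trans; rewrite -fB.
apply: bochner_measurable_complex; apply: continuous_borel_measurable; apply: part.
- exact: normr_Re_le.
- by move=> [a b] [c d].
- exact: normr_Im_le.
- by move=> [a b] [c d].
Qed.

Lemma cvg_pairl (X Y : topologicalType) (w : X) (c : Y) : (w', c) @[w' --> w] --> (w, c).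
Proof.
exact: (@cvg_pair _ _ _ (nbhs w) (nbhs w) (nbhs c) _ _ _ id (cst c) cvg_id (cvg_cst c)).
Qed.
Lemma cvg_pairr (X Y : topologicalType) (w : X) (c : Y) : (w, c') @[c' --> c] --> (w, c).
Proof.
exact: (@cvg_pair _ _ _ (nbhs c) (nbhs w) (nbhs c) _ _ _ (cst w) id (cvg_cst w) cvg_id).
Qed.

Theorem lemma4p5 (R : realType)
    (H : completeNormedModType R[i]) (dot : {dot H for Num.conj})
    (H_hilbert : is_hilbert dot) (H_separable : separable H)
    (Omega : ptopologicalType)
    (Omega_lc : locally_compact [set: Omega])
    (Omega_hausdorff : hausdorff_space Omega)
    (m : nat) (U : set 'rV[R]_m) (U_open : open U) (q : nat)
    (p : Omega -> 'rV[R]_m -> 'rV[R]_m -> R[i]^o)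
    (p_C0qq : C0class U q q p)
    (p_pd : forall w, positive_definite_kernel U (p w))
    (Lambda : set (borel Omega) -> 'L(H))
    (Lambda_radon_psd : radon_psd_measure dot Lambda)
    (lambda : {finite_measure set (borel Omega) -> \bar R})
    (G : borel Omega -> 'L(H))
    (Lambda_rn : radon_nikodym_decomposition lambda G Lambda)
    (p_dominated : dominated U q (variation Lambda) p) :
  let P (a b : 'I_m -> nat) (x y : 'rV[R]_m) : 'L(H) :=
    ovm_integral lambda G (fun w => mixed_partial a b (p w) x y) in
  forall a b : 'I_m -> nat, (multi_order a <= q)%N -> (multi_order b <= q)%N ->
    [/\ forall x y, U x -> U y ->
          ovm_integral_defined lambda G Lambda (fun w => mixed_partial a b (p w) x y),
        Cclass U (q - multi_order a) (q - multi_order b) (P a b),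
        has_mixed_partial U a b (P (fun=> 0%N) (fun=> 0%N)) &
        forall x y, U x -> U y ->
          mixed_partial a b (P (fun=> 0%N) (fun=> 0%N)) x y = P a b x y].
Proof.
move=> P; have [h [h_int p_le]] := p_dominated.
have oO := open_joint U_open; set O := U `*` U in oO.
pose K a b (w : borel Omega) := joint (mixed_partial a b (p w)).
have K_cont a b : (multi_order a <= q)%N -> (multi_order b <= q)%N ->
    forall w z, O z -> (fun s : Omega * ('rV[R]_m * 'rV[R]_m) => K a b s.1 s.2) s
      @[s --> ((w : Omega), z)] --> K a b w z.
  move=> aq bq w z Oz; have [_] := p_C0qq _ _ aq bq.
  rewrite continuous_open_subspace; first by move=> /(_ (w, z)) Kc; apply: Kc; rewrite inE.
  have -> : setT `*` O = snd @^-1` O :> set (Omega * ('rV[R]_m * 'rV[R]_m)).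
    by apply/seteqP; split=> s [].
  by apply: open_comp => // s _; exact: cvg_snd.
have K_dom a b : (multi_order a <= q)%N -> (multi_order b <= q)%N ->
    forall z, O z -> dominated_by h (fun w => K a b w z).
  move=> aq bq [x y] [/= Ux Uy]; split.
    apply: continuous_bochner_measurable => w.
    have Oz : O (x, y) by [].
    have pw : (w', (x, y)) @[w' --> (w : Omega)] --> ((w : Omega), (x, y)).
      exact: cvg_pairl.
    have Kc := K_cont a b aq bq w (x, y) Oz.
    have := @cvg_comp _ _ _ _ (fun s : Omega * ('rV[R]_m * 'rV[R]_m) => K a b s.1 s.2) _ _ _ pw Kc.
    by [].
  by move=> w; rewrite -lecR -!rnormE; exact: p_le.
have f_cont w a b : (multi_order a <= q)%N -> (multi_order b <= q)%N ->
    forall z, O z -> {for z, continuous (joint (mixed_partial a b (p w)))}.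
  move=> aq bq z Oz.
  have pz : ((w : Omega), z') @[z' --> z] --> ((w : Omega), z).
    exact: cvg_pairr.
  have Kc := K_cont a b aq bq w z Oz.
  have := @cvg_comp _ _ _ _ (fun s : Omega * ('rV[R]_m * 'rV[R]_m) => K a b s.1 s.2) _ _ _ pz Kc.
  by [].
have f_der w a b : (multi_order a <= q)%N -> (multi_order b <= q)%N ->
    has_mixed_partial U a b (p w).
  by move=> aq bq; have [] := p_C0qq _ _ aq bq.
(* Differentiation under the integral adds one to a multi-index of P, as it does
   for p itself by [has_dir_mixed_partial1] and [has_dir_mixed_partial2]. *)
have P1 a b i : (multi_order a < q)%N -> (multi_order b <= q)%N ->
    forall x y, U x -> U y ->
    has_partial_to ((P a b)^~ y) i x (P (add_multi a (unit_multi i)) b x y).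
  move=> aq bq x y Ux Uy; apply/has_dir_joint1.
  have aq' : (multi_order (add_multi a (unit_multi i)) <= q)%N.
    by rewrite multi_order_add multi_order_unit addn1.
  apply: (ovm_integral_has_dir Lambda_rn h_int oO (K := K a b)
    (K' := K (add_multi a (unit_multi i)) b)) => //.
  - exact: K_dom (ltnW aq) bq.
  - exact: K_dom.
  - by move=> w z Oz; exact: has_dir_mixed_partial1 (f_der w) (f_cont w) _ _ _ _ _ _ _.
have P2 a b i : (multi_order a <= q)%N -> (multi_order b < q)%N ->
    forall x y, U x -> U y ->
    has_partial_to (P a b x) i y (P a (add_multi b (unit_multi i)) x y).
  move=> aq bq x y Ux Uy; apply/has_dir_joint2.
  have bq' : (multi_order (add_multi b (unit_multi i)) <= q)%N.
    by rewrite multi_order_add multi_order_unit addn1.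
  apply: (ovm_integral_has_dir Lambda_rn h_int oO (K := K a b)
    (K' := K a (add_multi b (unit_multi i)))) => //.
  - exact: K_dom aq (ltnW bq).
  - exact: K_dom.
  - by move=> w z Oz; exact: has_dir_mixed_partial2 (f_der w) (f_cont w) _ _ _ _ _ _ _.
have P_mixed := closed_family_mixed_partial U_open P1 P2.
have zero : multi_order ((fun=> 0%N) : 'I_m -> nat) = 0%N by exact: big1.
move=> a b aq bq; split.
- move=> x y Ux Uy; apply: (ovm_integral_definedP Lambda_rn h_int).
  by apply: (K_dom _ _ aq bq (x, y)).
- move=> c d cq dq.
  have acq : (multi_order a + multi_order c <= q)%N by rewrite -leq_subRL.
  have bdq : (multi_order b + multi_order d <= q)%N by rewrite -leq_subRL.
  have [Pcd PE] := P_mixed _ _ _ _ acq bdq; split=> //.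
  rewrite continuous_open_subspace // => z /set_mem Oz.
  have acq' : (multi_order (add_multi a c) <= q)%N by rewrite multi_order_add.
  have bdq' : (multi_order (add_multi b d) <= q)%N by rewrite multi_order_add.
  have := ovm_integral_continuous Lambda_rn h_int oO (K := K (add_multi a c) (add_multi b d))
    (K_dom _ _ acq' bdq') (fun w => f_cont w _ _ acq' bdq') Oz.
  rewrite /continuous_at.
  have [Uz1 Uz2] := Oz; rewrite PE //.
  apply: cvg_trans; apply: near_eq_cvg.
  have : nbhs z O by apply: open_nbhs_nbhs.
  by apply: filterS => y [Uy1 Uy2]; rewrite PE.
- by have [] := P_mixed (fun=> 0%N) (fun=> 0%N) a b; rewrite ?zero.
- by have [] := P_mixed (fun=> 0%N) (fun=> 0%N) a b; rewrite ?zero.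
Qed.
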